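(* Let $k$ be a field and let $R$ be a Hopf $k$-algebra (with bijective antipode). (i) Fix the following data: a character $\chi$ of $R$; elements $z \in Z(R)\cap G(R)$ and $h \in Z(R)\cap P_{1,z}(R)$; a factorisation $z = y_+y_- = y_-y_+$ with $y_{\pm}\in Z(G(R))$ and $\chi(y_+)=\chi(y_-)=:\xi$. Define $\sigma := \tau^l_{\chi}$ and assume that the data are chosen such that $$\sigma = \mathrm{ad}_l(y_+)\circ \tau^r_{\chi}.$$ Then the ambiskew algebra $A = A(R,\widehat{X}_+,\widehat{X}_-,\sigma,h,\xi)$ has a Hopf algebra structure extending the given structure on $R$ and such that $$\Delta(\widehat{X}_{\pm}) = \widehat{X}_{\pm}\otimes 1 + y_{\pm}\otimes \widehat{X}_{\pm}.$$ The antipode $S$ of $R$ extends to an antipode of $A$ with $S(\widehat{X}_{\pm}) = -y_{\pm}^{-1}\widehat{X}_{\pm}$. (ii) Conversely, suppose that $A = A(R,X_+,X_-,\sigma,h,\xi)$ is an ambiskew algebra over $R$ which admits a structure of Hopf algebra extending the Hopf structure of $R$ and such that $$\Delta(X_{\pm}) = X_{\pm}\otimes r_{\pm} + l_{\pm}\otimes X_{\pm}$$ for some $l_{\pm}, r_{\pm}\in R$. Then $r_+$ and $r_-$ are invertible, and after the change of variables $\widehat{X}_{\pm} := X_{\pm}r_{\pm}^{-1}$ (with a corresponding adjustment of $\sigma,h,\xi$), $A$ is presented as an ambiskew algebra over $R$ in variables satisfying $\Delta(\widehat{X}_{\pm}) = \widehat{X}_{\pm}\otimes 1 + y_{\pm}\otimes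 \widehat{X}_{\pm}$ with $y_{\pm} := l_{\pm}r_{\pm}^{-1}$, and such that all the conditions on the data in (i) are satisfied (for a suitable character $\chi$ of $R$, with $z := y_+y_-$).
   Context: Ambiskew algebras: given a field $k$, a $k$-algebra $R$ (not necessarily commutative), a $k$-algebra automorphism $\sigma$ of $R$, a central element $h$ of $R$, and a nonzero $\xi\in k$, the ambiskew algebra $A = A(R,X_+,X_-,\sigma,h,\xi)$ is the $k$-algebra generated by $R$ and indeterminates $X_+,X_-$ subject to $X_+r = \sigma(r)X_+$, $X_-r = \sigma^{-1}(r)X_-$ for all $r\in R$, and $X_+X_- = h + \xi X_-X_+$. Hopf notation: $\Delta,\varepsilon,S$ are comultiplication, counit, antipode; all antipodes are assumed bijective; $\Delta(a)=\sum a_1\otimes a_2$. $G(R)$ is the group of grouplike elements, $Z(\cdot)$ denotes centre (of a ring or group). For $g,w\in G(R)$, $P_{g,w}(R)=\{a\in R:\Delta(a)=a\otimes g+w\otimes a\}$. A character of $R$ is a $k$-algebra homomorphism $\chi:R\to k$; the winding automorphisms are $\tau^r_{\chi}(a)=\sum a_1\chi(a_2)$ and $\tau^l_{\chi}(a)=\sum\chi(a_1)a_2$. The left adjoint action is $\mathrm{ad}_l(y)(a)=\sum y_1 a S(y_2)$; so for grouplike $y$, $\mathrm{ad}_l(y)(a)=yay^{-1}$. *)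

(* Defs.v *)
From HB Require Import structures.
From mathcomp Require Import all_boot all_algebra.
From mathcomp Require Import boolp.

Set Implicit Arguments.
Unset Strict Implicit.
Unset Printing Implicit Defensive.

Import GRing.Theory.
Local Open Scope ring_scope.
Local Open Scope quotient_scope.

Section Tensor.
Variables (k : fieldType) (V W : lmodType k).

(* A list [:: (v1, w1); ...; (vn, wn)] stands for the formal sum of the
   vi (x) wi; [tensor_rel] is the least congruence (for concatenation of
   formal sums) that makes (x) bilinear. *)
Inductive tensor_rel : seq (V * W) -> seq (V * W) -> Prop :=
| trel_refl s : tensor_rel s s
| trel_sym s t : tensor_rel s t -> tensor_rel t s
| trel_trans s t u : tensor_rel s t -> tensor_rel t u -> tensor_rel s u
| trel_cat s s' t t' :
    tensor_rel s s' -> tensor_rel t t' -> tensor_rel (s ++ t) (s' ++ t')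
| trel_catC s t : tensor_rel (s ++ t) (t ++ s)
| trel_zero w : tensor_rel [:: (0, w)] [::]
| trel_addl v v' w : tensor_rel [:: (v + v', w)] [:: (v, w); (v', w)]
| trel_addr v w w' : tensor_rel [:: (v, w + w')] [:: (v, w); (v, w')]
| trel_scale c v w : tensor_rel [:: (c *: v, w)] [:: (v, c *: w)].

Definition tensor_relb : rel (seq (V * W)) := fun s t => `[< tensor_rel s t >].

Lemma tensor_relb_refl : reflexive tensor_relb.
Proof. by move=> s; apply/asboolP; apply: trel_refl. Qed.

Lemma tensor_relb_sym : symmetric tensor_relb.
Proof. by move=> s t; apply: asbool_equiv_eq; split; apply: trel_sym. Qed.

Lemma tensor_relb_trans : transitive tensor_relb.
Proof.
by move=> t s u /asboolP st /asboolP tu; apply/asboolP; apply: trel_trans st tu.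
Qed.

Canonical tensor_equiv :=
  EquivRel tensor_relb tensor_relb_refl tensor_relb_sym tensor_relb_trans.

Definition tensor := {eq_quot tensor_equiv}.
HB.instance Definition _ := Choice.on tensor.

Definition tensor_of (s : seq (V * W)) : tensor := \pi_{eq_quot tensor_equiv} s.
Definition tensor_repr (x : tensor) : seq (V * W) := repr (x : {eq_quot tensor_equiv}).

Lemma tensor_reprK x : tensor_of (tensor_repr x) = x.
Proof. exact: reprK. Qed.

Lemma tensor_ofP s t : tensor_of s = tensor_of t <-> tensor_rel s t.
Proof. by split=> [/eqmodP/asboolP //|st]; apply/eqmodP/asboolP. Qed.

Lemma tensor_reprP s : tensor_rel (tensor_repr (tensor_of s)) s.
Proof. by apply/tensor_ofP; rewrite tensor_reprK. Qed.

Definition tens (v : V) (w : W) : tensor := tensor_of [:: (v, w)].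

Definition tensor_zero : tensor := tensor_of [::].
Definition tensor_add (x y : tensor) : tensor :=
  tensor_of (tensor_repr x ++ tensor_repr y).

Let scale_seq (c : k) (s : seq (V * W)) := [seq (c *: p.1, p.2) | p <- s].

Definition tensor_scale (c : k) (x : tensor) : tensor :=
  tensor_of (scale_seq c (tensor_repr x)).

Lemma tensor_of_cat s t :
  tensor_of (s ++ t) = tensor_add (tensor_of s) (tensor_of t).
Proof. by apply/tensor_ofP/trel_cat; apply: trel_sym; apply: tensor_reprP. Qed.

Let scale_seq_rel c s t : tensor_rel s t -> tensor_rel (scale_seq c s) (scale_seq c t).
Proof.
elim=> {s t} /=.
- by move=> s; apply: trel_refl.
- by move=> s t _; apply: trel_sym.
- by move=> s t u _ st _; apply: trel_trans.
- by move=> s s' t t' _ ss' _ tt'; rewrite /scale_seq !map_cat; apply: trel_cat.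
- by move=> s t; rewrite /scale_seq !map_cat; apply: trel_catC.
- by move=> w; rewrite scaler0; apply: trel_zero.
- by move=> v v' w; rewrite scalerDr; apply: trel_addl.
- by move=> v w w'; apply: trel_addr.
- by move=> d v w; rewrite scalerA mulrC -scalerA; apply: trel_scale.
Qed.

Lemma tensor_of_scale c s : tensor_of (scale_seq c s) = tensor_scale c (tensor_of s).
Proof. by apply/tensor_ofP/scale_seq_rel/trel_sym/tensor_reprP. Qed.

Lemma tensor_of_ind (P : tensor -> Prop) : (forall s, P (tensor_of s)) -> forall x, P x.
Proof. by move=> Ps x; rewrite -(tensor_reprK x). Qed.

Lemma tensor_addA : associative tensor_add.
Proof.
elim/tensor_of_ind=> s; elim/tensor_of_ind=> t; elim/tensor_of_ind=> u.
by rewrite -!tensor_of_cat catA.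
Qed.

Lemma tensor_addC : commutative tensor_add.
Proof.
elim/tensor_of_ind=> s; elim/tensor_of_ind=> t.
by rewrite -!tensor_of_cat; apply/tensor_ofP/trel_catC.
Qed.

Lemma tensor_add0 : left_id tensor_zero tensor_add.
Proof. by elim/tensor_of_ind=> s; rewrite -tensor_of_cat. Qed.

Let scale_seqD c d s :
  tensor_rel (scale_seq (c + d) s) (scale_seq c s ++ scale_seq d s).
Proof.
elim: s => [|p s IHs] /=; first exact: trel_refl.
apply: (@trel_trans _ ([:: (c *: p.1, p.2); (d *: p.1, p.2)] ++
                       (scale_seq c s ++ scale_seq d s))).
  rewrite scalerDl -cat1s; apply: trel_cat IHs; exact: trel_addl.
rewrite -[X in tensor_rel X _]/([:: (c *: p.1, p.2)] ++ ([:: (d *: p.1, p.2)] ++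
  (scale_seq c s ++ scale_seq d s))).
rewrite -[X in tensor_rel _ X]/([:: (c *: p.1, p.2)] ++
  (scale_seq c s ++ ([:: (d *: p.1, p.2)] ++ scale_seq d s))).
apply: trel_cat; first exact: trel_refl.
by rewrite !catA; apply: trel_cat (trel_refl _); apply: trel_catC.
Qed.

Let scale_seq0 s : tensor_rel (scale_seq 0 s) [::].
Proof.
elim: s => [|p s IHs] /=; first exact: trel_refl.
rewrite scale0r -cat1s -[X in tensor_rel _ X]cat0s.
by apply: trel_cat IHs; apply: trel_zero.
Qed.

Lemma tensor_scaleDl x : {morph tensor_scale^~ x : c d / c + d >-> tensor_add c d}.
Proof.
elim/tensor_of_ind: x => s c d.
by rewrite -!tensor_of_scale -tensor_of_cat; apply/tensor_ofP.
Qed.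

Lemma tensor_scale0 x : tensor_scale 0 x = tensor_zero.
Proof. by elim/tensor_of_ind: x => s; rewrite -tensor_of_scale; apply/tensor_ofP. Qed.

Lemma tensor_scale1 : left_id 1 tensor_scale.
Proof.
elim/tensor_of_ind=> s; rewrite -tensor_of_scale /scale_seq.
by congr tensor_of; elim: s => //= -[a b] s ->; rewrite scale1r.
Qed.

Lemma tensor_addN : left_inverse tensor_zero (tensor_scale (- 1)) tensor_add.
Proof. by move=> x; rewrite -{2}[x]tensor_scale1 -tensor_scaleDl addNr tensor_scale0. Qed.

HB.instance Definition _ := GRing.isZmodule.Build tensor
  tensor_addA tensor_addC tensor_add0 tensor_addN.

Lemma tensor_scaleA c d x : tensor_scale c (tensor_scale d x) = tensor_scale (c * d) x.
Proof.
elim/tensor_of_ind: x => s; rewrite -!tensor_of_scale /scale_seq -map_comp.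
by congr tensor_of; apply: eq_map => p /=; rewrite scalerA.
Qed.

Lemma tensor_scaleDr : right_distributive tensor_scale +%R.
Proof.
move=> c; elim/tensor_of_ind=> s; elim/tensor_of_ind=> t.
rewrite -[tensor_of s + _]tensor_of_cat -!tensor_of_scale.
by rewrite -[_ + _]tensor_of_cat /scale_seq map_cat.
Qed.

HB.instance Definition _ := GRing.Zmodule_isLmodule.Build k tensor
  tensor_scaleA tensor_scale1 tensor_scaleDr tensor_scaleDl.

Lemma tensor_ofE s : tensor_of s = \sum_(p <- s) tens p.1 p.2.
Proof.
elim: s => [|p s IHs]; first by rewrite big_nil.
by rewrite big_cons -IHs -cat1s tensor_of_cat; case: p.
Qed.

Lemma tensDl v v' w : tens (v + v') w = tens v w + tens v' w.
Proof. by rewrite -[_ + tens _ _]tensor_of_cat; apply/tensor_ofP/trel_addl. Qed.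

Lemma tensDr v w w' : tens v (w + w') = tens v w + tens v w'.
Proof. by rewrite -[_ + tens _ _]tensor_of_cat; apply/tensor_ofP/trel_addr. Qed.

Lemma tensZl c v w : tens (c *: v) w = c *: tens v w.
Proof. by rewrite -[RHS]tensor_of_scale. Qed.

Lemma tensZr c v w : tens v (c *: w) = c *: tens v w.
Proof. by rewrite -tensZl; apply/tensor_ofP/trel_sym/trel_scale. Qed.

Lemma tensor_ind (P : tensor -> Prop) :
    (forall v w, P (tens v w)) -> P 0 -> (forall x y, P x -> P y -> P (x + y)) ->
  forall x, P x.
Proof.
move=> Pt P0 PD; elim/tensor_of_ind=> s; rewrite tensor_ofE.
by elim/big_ind: _ => // p _; apply: Pt.
Qed.

(* The linear map on V (x) W induced by f; only meaningful for bilinear f. *)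
Definition tlift (U : lmodType k) (f : V -> W -> U) (x : tensor) : U :=
  \sum_(p <- tensor_repr x) f p.1 p.2.

Definition bilinear_map (U : lmodType k) (f : V -> W -> U) :=
  (forall w, linear (f^~ w)) /\ (forall v, linear (f v)).

Section Lift.
Variables (U : lmodType k) (f : V -> W -> U).
Hypothesis f_bilin : bilinear_map f.

Let fDl v v' w : f (v + v') w = f v w + f v' w.
Proof. by have := f_bilin.1 w 1 v v'; rewrite !scale1r. Qed.
Let fDr v w w' : f v (w + w') = f v w + f v w'.
Proof. by have := f_bilin.2 v 1 w w'; rewrite !scale1r. Qed.
Let f0l w : f 0 w = 0.
Proof. by apply: (@addrI _ (f 0 w)); rewrite -fDl !addr0. Qed.
Let f0r v : f v 0 = 0.
Proof. by apply: (@addrI _ (f v 0)); rewrite -fDr !addr0. Qed.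
Let fZl c v w : f (c *: v) w = c *: f v w.
Proof. by have := f_bilin.1 w c v 0; rewrite f0l !addr0. Qed.
Let fZr c v w : f v (c *: w) = c *: f v w.
Proof. by have := f_bilin.2 v c w 0; rewrite f0r !addr0. Qed.

Lemma tlift_of s : tlift f (tensor_of s) = \sum_(p <- s) f p.1 p.2.
Proof.
have E s' t : tensor_rel s' t ->
    \sum_(p <- s') f p.1 p.2 = \sum_(p <- t) f p.1 p.2; last first.
  by apply: E; apply: tensor_reprP.
elim=> {s s' t} //=.
- by move=> s t u _ -> _ ->.
- by move=> s s' t t' _ ss' _ tt'; rewrite !big_cat /= ss' tt'.
- by move=> s t; rewrite !big_cat /= addrC.
- by move=> w; rewrite big_seq1 big_nil f0l.
- by move=> v v' w; rewrite big_seq1 !big_cons big_nil addr0 fDl.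
- by move=> v w w'; rewrite big_seq1 !big_cons big_nil addr0 fDr.
- by move=> c v w; rewrite !big_seq1 fZl fZr.
Qed.

Lemma tlift_tens v w : tlift f (tens v w) = f v w.
Proof. by rewrite tlift_of big_seq1. Qed.

Lemma tlift_linear : linear (tlift f).
Proof.
move=> c; elim/tensor_of_ind=> s; elim/tensor_of_ind=> t.
rewrite -[_ *: _]tensor_of_scale -[_ + _]tensor_of_cat !tlift_of big_cat /=.
by rewrite big_map scaler_sumr; congr (_ + _); apply: eq_bigr => p _; apply: fZl.
Qed.

Lemma tliftD x y : tlift f (x + y) = tlift f x + tlift f y.
Proof. by have := tlift_linear 1 x y; rewrite !scale1r. Qed.

Lemma tlift0 : tlift f 0 = 0.
Proof. by apply: (@addrI _ (tlift f 0)); rewrite -tliftD !addr0. Qed.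

Lemma tliftZ c x : tlift f (c *: x) = c *: tlift f x.
Proof. by have := tlift_linear c x 0; rewrite tlift0 !addr0. Qed.

End Lift.

End Tensor.

Notation "V ⊗ W" := (tensor V%type W%type) (at level 40, left associativity) : type_scope.
Notation "v ⊗ w" := (tens v w) (at level 40, left associativity) : ring_scope.

Definition tmap (k : fieldType) (V W V' W' : lmodType k)
    (f : V -> V') (g : W -> W') (x : V ⊗ W) : V' ⊗ W' :=
  tlift (fun v w => f v ⊗ g w) x.

Definition tassoc (k : fieldType) (U V W : lmodType k) (x : (U ⊗ V) ⊗ W) :
    U ⊗ (V ⊗ W) :=
  tlift (fun y w => tlift (fun u v => u ⊗ (v ⊗ w)) y) x.

Section TensorAlgebra.
Variables (k : fieldType) (A B : algType k).

Definition tensor_mul (x y : A ⊗ B) : A ⊗ B :=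
  tlift (fun a b => tlift (fun a' b' => (a * a') ⊗ (b * b')) y) x.

Let bilin_inner a b :
  bilinear_map (fun (a' : A) (b' : B) => (a * a') ⊗ (b * b') : A ⊗ B).
Proof.
by split=> [w c x y|v c x y]; rewrite mulrDr -scalerAr ?tensDl ?tensDr ?tensZl ?tensZr.
Qed.

Let bilin_outer y :
  bilinear_map (fun a b => tlift (fun a' b' => (a * a') ⊗ (b * b') : A ⊗ B) y).
Proof.
split=> [b c a1 a2|a c b1 b2]; elim/tensor_ind: y => [v w||x y].
- by rewrite !(tlift_tens (bilin_inner _ _)) mulrDl -scalerAl tensDl tensZl.
- by rewrite !(tlift0 (bilin_inner _ _)) scaler0 addr0.
- by rewrite !(tliftD (bilin_inner _ _)) => -> ->; rewrite scalerDr addrACA.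
- by rewrite !(tlift_tens (bilin_inner _ _)) mulrDl -scalerAl tensDr tensZr.
- by rewrite !(tlift0 (bilin_inner _ _)) scaler0 addr0.
- by rewrite !(tliftD (bilin_inner _ _)) => -> ->; rewrite scalerDr addrACA.
Qed.

Lemma tensor_mul_tens a b a' b' :
  tensor_mul (a ⊗ b) (a' ⊗ b') = (a * a') ⊗ (b * b').
Proof. by rewrite /tensor_mul !(tlift_tens (bilin_outer _), tlift_tens (bilin_inner _ _)). Qed.

Lemma tensor_mulDl : left_distributive tensor_mul +%R.
Proof. by move=> x y z; apply: tliftD. Qed.

Lemma tensor_mulDr : right_distributive tensor_mul +%R.
Proof.
move=> x y z; elim/tensor_ind: x => [a b||x1 x2].
- by rewrite /tensor_mul !(tlift_tens (bilin_outer _)) (tliftD (bilin_inner _ _)).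
- by rewrite /tensor_mul !(tlift0 (bilin_outer _)) addr0.
- by rewrite !tensor_mulDl => -> ->; rewrite addrACA.
Qed.

Let mul0l x : tensor_mul 0 x = 0.
Proof. by apply: (@addrI _ (tensor_mul 0 x)); rewrite -tensor_mulDl !addr0. Qed.
Let mul0r x : tensor_mul x 0 = 0.
Proof. by apply: (@addrI _ (tensor_mul x 0)); rewrite -tensor_mulDr !addr0. Qed.

Lemma tensor_mulA : associative tensor_mul.
Proof.
move=> x y z; elim/tensor_ind: x => [a b||x x']; first last.
- by rewrite !tensor_mulDl => -> ->.
- by rewrite !mul0l.
elim/tensor_ind: y => [a1 b1||y y']; first last.
- by rewrite !(tensor_mulDl, tensor_mulDr) => -> ->.
- by rewrite !(mul0l, mul0r).
elim/tensor_ind: z => [a2 b2||z z']; first last.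
- by rewrite !tensor_mulDr => -> ->.
- by rewrite !mul0r.
by rewrite !tensor_mul_tens !mulrA.
Qed.

Lemma tensor_mul1l : left_id (1 ⊗ 1) tensor_mul.
Proof.
elim/tensor_ind=> [a b||x y]; first by rewrite tensor_mul_tens !mul1r.
- by rewrite mul0r.
- by rewrite tensor_mulDr => -> ->.
Qed.

Lemma tensor_mul1r : right_id (1 ⊗ 1) tensor_mul.
Proof.
elim/tensor_ind=> [a b||x y]; first by rewrite tensor_mul_tens !mulr1.
- by rewrite mul0l.
- by rewrite tensor_mulDl => -> ->.
Qed.

HB.instance Definition _ := GRing.Zmodule_isPzRing.Build (tensor A B)
  tensor_mulA tensor_mul1l tensor_mul1r tensor_mulDl tensor_mulDr.

Lemma tens_mul a b a' b' :
  (a ⊗ b : A ⊗ B) * (a' ⊗ b') = (a * a') ⊗ (b * b').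
Proof. exact: tensor_mul_tens. Qed.

Lemma tens_one : 1 = 1 ⊗ 1 :> (A ⊗ B).
Proof. by []. Qed.

End TensorAlgebra.

(* [hopf_comul] is only typed as linear: its multiplicativity is a field because
   A ⊗ A is declared as a [pzRingType], and [lrmorphism] asks for an [lalgType]. *)
Record hopf (k : fieldType) (A : algType k) := Hopf {
  hopf_comul : {linear A -> (A ⊗ A)%type};
  hopf_counit : {lrmorphism A -> k^o};
  hopf_antipode : {linear A -> A};
  hopf_comul_mult : monoid_morphism hopf_comul;
  hopf_coassoc : forall a,
    tassoc (tmap hopf_comul idfun (hopf_comul a)) =
    tmap idfun hopf_comul (hopf_comul a);
  hopf_counitl : forall a,
    tlift (fun a1 a2 => hopf_counit a1 *: a2) (hopf_comul a) = a;
  hopf_counitr : forall a,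
    tlift (fun a1 a2 => hopf_counit a2 *: a1) (hopf_comul a) = a;
  hopf_antipodel : forall a,
    tlift (fun a1 a2 => hopf_antipode a1 * a2) (hopf_comul a) = hopf_counit a *: 1;
  hopf_antipoder : forall a,
    tlift (fun a1 a2 => a1 * hopf_antipode a2) (hopf_comul a) = hopf_counit a *: 1;
  hopf_antipode_bij : bijective hopf_antipode
}.

Section HopfNotions.
Variables (k : fieldType) (R : algType k) (H : hopf R).

Local Notation Delta := (hopf_comul H).

Definition central (x : R) : Prop := forall y, x * y = y * x.

Definition grouplike (g : R) : Prop := Delta g = g ⊗ g /\ hopf_counit H g = 1.

Definition central_grouplike (g : R) : Prop :=
  grouplike g /\ forall g', grouplike g' -> g * g' = g' * g.

(* P_{g,w}(R) *)
Definition skew_primitive (g w a : R) : Prop := Delta a = a ⊗ g + w ⊗ a.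

Definition winding_l (chi : {lrmorphism R -> k^o}) (a : R) : R :=
  tlift (fun a1 a2 => chi a1 *: a2) (Delta a).

Definition winding_r (chi : {lrmorphism R -> k^o}) (a : R) : R :=
  tlift (fun a1 a2 => chi a2 *: a1) (Delta a).

Definition ad_l (y a : R) : R :=
  tlift (fun y1 y2 => y1 * a * hopf_antipode H y2) (Delta y).

End HopfNotions.

Definition hopf_extends (k : fieldType) (R A : algType k) (HR : hopf R) (HA : hopf A)
    (i : R -> A) : Prop :=
  [/\ forall r, hopf_comul HA (i r) = tmap i i (hopf_comul HR r),
      forall r, hopf_counit HA (i r) = hopf_counit HR r &
      forall r, hopf_antipode HA (i r) = i (hopf_antipode HR r)].

Definition inverse_of (R : pzRingType) (x y : R) : Prop := x * y = 1 /\ y * x = 1.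

Record ambiskew_data (k : fieldType) (R : algType k) := AmbiskewData {
  as_sigma : {lrmorphism R -> R};
  as_sigmaV : R -> R;
  as_sigmaK : cancel as_sigma as_sigmaV;
  as_sigmaVK : cancel as_sigmaV as_sigma;
  as_h : R;
  as_h_central : central as_h;
  as_xi : k;
  as_xi_neq0 : as_xi != 0
}.

Arguments as_sigmaK {k R} a.
Arguments as_sigmaVK {k R} a.
Arguments as_h_central {k R} a.
Arguments as_xi_neq0 {k R} a.

Section Ambiskew.
Variables (k : fieldType) (R : algType k) (D : ambiskew_data R).

Local Notation sigma := (as_sigma D).
Local Notation sigmaV := (as_sigmaV D).
Local Notation h := (as_h D).
Local Notation xi := (as_xi D).

Inductive aterm :=
| ACoef of R
| AXp
| AXm
| AAdd of aterm & aterm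
| AMul of aterm & aterm.

HB.instance Definition _ := gen_eqMixin aterm.
HB.instance Definition _ := gen_choiceMixin aterm.

(* The least k-algebra congruence on terms for which [ACoef] is a morphism of
   algebras and the three families of defining relations hold. The scalar c acts
   as [ACoef c%:A], and the opposite of x is [AMul (ACoef (- 1)) x]. *)
Inductive ambiskew_rel : aterm -> aterm -> Prop :=
| arel_refl x : ambiskew_rel x x
| arel_sym x y : ambiskew_rel x y -> ambiskew_rel y x
| arel_trans x y z : ambiskew_rel x y -> ambiskew_rel y z -> ambiskew_rel x z
| arel_add x x' y y' :
    ambiskew_rel x x' -> ambiskew_rel y y' -> ambiskew_rel (AAdd x y) (AAdd x' y')
| arel_mul x x' y y' :
    ambiskew_rel x x' -> ambiskew_rel y y' -> ambiskew_rel (AMul x y) (AMul x' y')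
| arel_addA x y z : ambiskew_rel (AAdd x (AAdd y z)) (AAdd (AAdd x y) z)
| arel_addC x y : ambiskew_rel (AAdd x y) (AAdd y x)
| arel_add0 x : ambiskew_rel (AAdd (ACoef 0) x) x
| arel_addN x : ambiskew_rel (AAdd (AMul (ACoef (- 1)) x) x) (ACoef 0)
| arel_mulA x y z : ambiskew_rel (AMul x (AMul y z)) (AMul (AMul x y) z)
| arel_mul1l x : ambiskew_rel (AMul (ACoef 1) x) x
| arel_mul1r x : ambiskew_rel (AMul x (ACoef 1)) x
| arel_mulDl x y z : ambiskew_rel (AMul (AAdd x y) z) (AAdd (AMul x z) (AMul y z))
| arel_mulDr x y z : ambiskew_rel (AMul x (AAdd y z)) (AAdd (AMul x y) (AMul x z))
| arel_scalar (c : k) x : ambiskew_rel (AMul (ACoef c%:A) x) (AMul x (ACoef c%:A))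
| arel_coefD r s : ambiskew_rel (ACoef (r + s)) (AAdd (ACoef r) (ACoef s))
| arel_coefM r s : ambiskew_rel (ACoef (r * s)) (AMul (ACoef r) (ACoef s))
| arel_Xp r : ambiskew_rel (AMul AXp (ACoef r)) (AMul (ACoef (sigma r)) AXp)
| arel_Xm r : ambiskew_rel (AMul AXm (ACoef r)) (AMul (ACoef (sigmaV r)) AXm)
| arel_XpXm :
    ambiskew_rel (AMul AXp AXm)
                 (AAdd (ACoef h) (AMul (ACoef xi%:A) (AMul AXm AXp))).

Definition ambiskew_relb : rel aterm := fun x y => `[< ambiskew_rel x y >].

Lemma ambiskew_relb_refl : reflexive ambiskew_relb.
Proof. by move=> s; apply/asboolP; apply: arel_refl. Qed.

Lemma ambiskew_relb_sym : symmetric ambiskew_relb.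
Proof. by move=> s t; apply: asbool_equiv_eq; split; apply: arel_sym. Qed.

Lemma ambiskew_relb_trans : transitive ambiskew_relb.
Proof.
by move=> t s u /asboolP st /asboolP tu; apply/asboolP; apply: arel_trans st tu.
Qed.

Canonical ambiskew_equiv :=
  EquivRel ambiskew_relb ambiskew_relb_refl ambiskew_relb_sym ambiskew_relb_trans.

Definition ambiskew := {eq_quot ambiskew_equiv}.
HB.instance Definition _ := Choice.on ambiskew.

Definition as_of (x : aterm) : ambiskew := \pi_{eq_quot ambiskew_equiv} x.
Definition as_repr (x : ambiskew) : aterm := repr (x : {eq_quot ambiskew_equiv}).

Lemma as_reprK x : as_of (as_repr x) = x.
Proof. exact: reprK. Qed.

Lemma as_ofP x y : as_of x = as_of y <-> ambiskew_rel x y.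
Proof. by split=> [/eqmodP/asboolP //|xy]; apply/eqmodP/asboolP. Qed.

Lemma as_of_ind (P : ambiskew -> Prop) : (forall x, P (as_of x)) -> forall x, P x.
Proof. by move=> Px x; rewrite -(as_reprK x). Qed.

Definition as_coef (r : R) : ambiskew := as_of (ACoef r).
Definition as_Xp : ambiskew := as_of AXp.
Definition as_Xm : ambiskew := as_of AXm.
Definition as_add (x y : ambiskew) : ambiskew := as_of (AAdd (as_repr x) (as_repr y)).
Definition as_mul (x y : ambiskew) : ambiskew := as_of (AMul (as_repr x) (as_repr y)).
Definition as_opp (x : ambiskew) : ambiskew := as_mul (as_coef (- 1)) x.
Definition as_scale (c : k) (x : ambiskew) : ambiskew := as_mul (as_coef c%:A) x.

Lemma as_of_add x y : as_of (AAdd x y) = as_add (as_of x) (as_of y).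
Proof. by apply/as_ofP/arel_add; apply/as_ofP; rewrite as_reprK. Qed.

Lemma as_of_mul x y : as_of (AMul x y) = as_mul (as_of x) (as_of y).
Proof. by apply/as_ofP/arel_mul; apply/as_ofP; rewrite as_reprK. Qed.

Lemma as_addA : associative as_add.
Proof.
elim/as_of_ind=> x; elim/as_of_ind=> y; elim/as_of_ind=> z.
by rewrite -!as_of_add; apply/as_ofP/arel_addA.
Qed.

Lemma as_addC : commutative as_add.
Proof.
by elim/as_of_ind=> x; elim/as_of_ind=> y; rewrite -!as_of_add; apply/as_ofP/arel_addC.
Qed.

Lemma as_add0 : left_id (as_coef 0) as_add.
Proof. by elim/as_of_ind=> x; rewrite -!as_of_add; apply/as_ofP/arel_add0. Qed.

Lemma as_addN : left_inverse (as_coef 0) as_opp as_add.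
Proof.
by elim/as_of_ind=> x; rewrite /as_opp -as_of_mul -as_of_add; apply/as_ofP/arel_addN.
Qed.

HB.instance Definition _ := GRing.isZmodule.Build ambiskew
  as_addA as_addC as_add0 as_addN.

Lemma as_mulA : associative as_mul.
Proof.
elim/as_of_ind=> x; elim/as_of_ind=> y; elim/as_of_ind=> z.
by rewrite -!as_of_mul; apply/as_ofP/arel_mulA.
Qed.

Lemma as_mul1l : left_id (as_coef 1) as_mul.
Proof. by elim/as_of_ind=> x; rewrite -!as_of_mul; apply/as_ofP/arel_mul1l. Qed.

Lemma as_mul1r : right_id (as_coef 1) as_mul.
Proof. by elim/as_of_ind=> x; rewrite -!as_of_mul; apply/as_ofP/arel_mul1r. Qed.

Lemma as_mulDl : left_distributive as_mul +%R.
Proof.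
elim/as_of_ind=> x; elim/as_of_ind=> y; elim/as_of_ind=> z.
rewrite -[as_of x + _]as_of_add -!as_of_mul -[_ + _]as_of_add.
exact/as_ofP/arel_mulDl.
Qed.

Lemma as_mulDr : right_distributive as_mul +%R.
Proof.
elim/as_of_ind=> x; elim/as_of_ind=> y; elim/as_of_ind=> z.
rewrite -[as_of y + _]as_of_add -!as_of_mul -[_ + _]as_of_add.
exact/as_ofP/arel_mulDr.
Qed.

HB.instance Definition _ := GRing.Zmodule_isPzRing.Build ambiskew
  as_mulA as_mul1l as_mul1r as_mulDl as_mulDr.

Lemma as_coefD r s : as_coef (r + s) = as_coef r + as_coef s.
Proof. by rewrite -[RHS]as_of_add; apply/as_ofP/arel_coefD. Qed.

Lemma as_coefM r s : as_coef (r * s) = as_coef r * as_coef s.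
Proof. by rewrite -[RHS]as_of_mul; apply/as_ofP/arel_coefM. Qed.

Lemma as_coef_scalar c x : as_coef c%:A * x = x * as_coef c%:A.
Proof.
elim/as_of_ind: x => x.
rewrite -[LHS]as_of_mul -[RHS]as_of_mul; exact/as_ofP/arel_scalar.
Qed.

Lemma as_Xp_coef r : as_Xp * as_coef r = as_coef (sigma r) * as_Xp.
Proof. by rewrite -[LHS]as_of_mul -[RHS]as_of_mul; apply/as_ofP/arel_Xp. Qed.

Lemma as_Xm_coef r : as_Xm * as_coef r = as_coef (sigmaV r) * as_Xm.
Proof. by rewrite -[LHS]as_of_mul -[RHS]as_of_mul; apply/as_ofP/arel_Xm. Qed.

(* A representation of the presented algebra on sequences of elements of R,
   used to show that it is not the zero ring. *)
Fixpoint as_hseq (n : nat) : R :=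
  if n is m.+1 then h + xi *: sigmaV (as_hseq m) else 0.

Fixpoint as_act (x : aterm) (f : nat -> R) : nat -> R :=
  match x with
  | ACoef r => fun n => r * f n
  | AXp => fun n => sigma (f n.+1) * as_hseq n.+1
  | AXm => fun n => if n is m.+1 then sigmaV (f m) else 0
  | AAdd x y => fun n => as_act x f n + as_act y f n
  | AMul x y => as_act x (as_act y f)
  end.

Lemma as_sigmaVD : {morph sigmaV : x y / x + y}.
Proof. by move=> x y; apply: (can_inj (as_sigmaK D)); rewrite raddfD /= !as_sigmaVK. Qed.

Lemma as_sigmaVM : {morph sigmaV : x y / x * y}.
Proof. by move=> x y; apply: (can_inj (as_sigmaK D)); rewrite rmorphM /= !as_sigmaVK. Qed.

Lemma as_sigmaVZ c x : sigmaV (c *: x) = c *: sigmaV x.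
Proof. by apply: (can_inj (as_sigmaK D)); rewrite linearZ /= !as_sigmaVK. Qed.

Lemma as_sigmaV0 : sigmaV 0 = 0.
Proof. by rewrite -[in LHS](raddf0 sigma) as_sigmaK. Qed.

Lemma as_act_ext x f g : f =1 g -> as_act x f =1 as_act x g.
Proof.
elim: x f g => [r||| x IHx y IHy|x IHx y IHy] f g fg n //=.
- by rewrite fg.
- by rewrite fg.
- by case: n => // n; rewrite fg.
- by rewrite (IHx _ _ fg) (IHy _ _ fg).
- by apply: IHx => m; apply: IHy.
Qed.

Lemma as_actD x f g n : as_act x (fun m => f m + g m) n = as_act x f n + as_act x g n.
Proof.
elim: x f g n => [r||| x IHx y IHy|x IHx y IHy] f g n /=.
- by rewrite mulrDr.
- by rewrite raddfD mulrDl.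
- by case: n => [|n]; rewrite ?addr0 ?as_sigmaVD.
- by rewrite IHx IHy addrACA.
- by rewrite -IHx; apply: as_act_ext => m; apply: IHy.
Qed.

Lemma as_actZ x c f n : as_act x (fun m => c *: f m) n = c *: as_act x f n.
Proof.
elim: x f n => [r||| x IHx y IHy|x IHx y IHy] f n /=.
- by rewrite scalerAr.
- by rewrite linearZ scalerAl.
- by case: n => [|n]; rewrite ?scaler0 ?as_sigmaVZ.
- by rewrite IHx IHy scalerDr.
- by rewrite -IHx; apply: as_act_ext => m; apply: IHy.
Qed.

Lemma as_act_rel x y : ambiskew_rel x y -> forall f, as_act x f =1 as_act y f.
Proof.
elim=> {x y} //=.
- by move=> x y _ xy f n; rewrite xy.
- by move=> x y z _ xy _ yz f n; rewrite xy yz.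
- by move=> x x' y y' _ xx' _ yy' f n; rewrite xx' yy'.
- by move=> x x' y y' _ xx' _ yy' f n; rewrite xx'; apply: as_act_ext.
- by move=> x y z f n; rewrite addrA.
- by move=> x y f n; rewrite addrC.
- by move=> x f n; rewrite mul0r add0r.
- by move=> x f n; rewrite mulN1r addNr mul0r.
- by move=> x f n; rewrite mul1r.
- by move=> x f n; apply: as_act_ext => m; rewrite mul1r.
- by move=> x y z f n; rewrite as_actD.
- move=> c x f n; rewrite -scalerAl mul1r -as_actZ.
  by apply: as_act_ext => m; rewrite -scalerAl mul1r.
- by move=> r s f n; rewrite mulrDl.
- by move=> r s f n; rewrite mulrA.
- by move=> r f n; rewrite rmorphM mulrA.
- by move=> r f [|n]; rewrite ?mulr0 ?as_sigmaVM.
- move=> f n; rewrite as_sigmaVK mulrDr (as_h_central D) -!scalerAl mul1r -scalerAr.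
  congr (_ + _ *: _); case: n => [|n] /=; first by rewrite as_sigmaV0 mulr0.
  by rewrite as_sigmaVM as_sigmaK.
Qed.

Lemma as_coef_inj : injective as_coef.
Proof.
move=> r s /as_ofP/as_act_rel/(_ (fun=> 1) 0%N) /=.
by rewrite !mulr1.
Qed.

Lemma as_oner_neq0 : (1 : ambiskew) != 0.
Proof.
by apply/eqP => /as_coef_inj/eqP; rewrite oner_eq0.
Qed.

HB.instance Definition _ := GRing.PzSemiRing_isNonZero.Build ambiskew as_oner_neq0.

Lemma as_scaleA c d x : as_scale c (as_scale d x) = as_scale (c * d) x.
Proof.
rewrite -[LHS]/(as_coef c%:A * (as_coef d%:A * x)) -[RHS]/(as_coef (c * d)%:A * x).
by rewrite mulrA -as_coefM -scalerAl mul1r scalerA.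
Qed.

Lemma as_scale1 : left_id 1 as_scale.
Proof. by move=> x; rewrite /as_scale scale1r; apply: as_mul1l. Qed.

Lemma as_scaleDr : right_distributive as_scale +%R.
Proof. by move=> c x y; apply: as_mulDr. Qed.

Lemma as_scaleDl x : {morph as_scale^~ x : c d / c + d}.
Proof. by move=> c d; rewrite /as_scale scalerDl as_coefD; apply: as_mulDl. Qed.

HB.instance Definition _ := GRing.Zmodule_isLmodule.Build k ambiskew
  as_scaleA as_scale1 as_scaleDr as_scaleDl.

Lemma as_scalerAl (c : k) (x y : ambiskew) : c *: (x * y) = c *: x * y.
Proof. exact: as_mulA. Qed.

HB.instance Definition _ := GRing.Lmodule_isLalgebra.Build k ambiskew as_scalerAl.

Lemma as_scalerAr (c : k) (x y : ambiskew) : c *: (x * y) = x * (c *: y).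
Proof.
rewrite -[LHS]/(as_coef c%:A * (x * y)) -[c *: y]/(as_coef c%:A * y).
by rewrite mulrA as_coef_scalar mulrA.
Qed.

HB.instance Definition _ := GRing.Lalgebra_isAlgebra.Build k ambiskew as_scalerAr.

Lemma as_coef_linear : linear as_coef.
Proof. by move=> c x y; rewrite as_coefD -{1}[x]mul1r scalerAl as_coefM. Qed.

Lemma as_coef_monoid : monoid_morphism as_coef.
Proof. by split=> // x y; apply: as_coefM. Qed.

HB.instance Definition _ := GRing.isLinear.Build k R ambiskew _ as_coef as_coef_linear.
HB.instance Definition _ := GRing.isMonoidMorphism.Build R ambiskew as_coef as_coef_monoid.

Lemma as_XpXm : as_Xp * as_Xm = as_coef h + xi *: (as_Xm * as_Xp).
Proof.
rewrite -[as_Xp * _]as_of_mul -[as_Xm * _]as_of_mul -[_ *: _]as_of_mul.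
by rewrite -[RHS]as_of_add; apply/as_ofP/arel_XpXm.
Qed.

End Ambiskew.

(* A is the ambiskew algebra with data D, for the structure map i : R -> A and the
   variables xp, xm. *)
Definition presented_by (k : fieldType) (R : algType k) (D : ambiskew_data R)
    (A : algType k) (i : R -> A) (xp xm : A) : Prop :=
  exists phi : {lrmorphism ambiskew D -> A},
    [/\ bijective phi, forall r, phi (as_coef D r) = i r,
        phi (as_Xp D) = xp & phi (as_Xm D) = xm].

Record hopf_conditions (k : fieldType) (R : algType k) (H : hopf R)
    (chi : {lrmorphism R -> k^o}) (z h yp ym : R) : Prop := HopfConditions {
  hc_z_central : central z;
  hc_z_grouplike : grouplike H z;
  hc_h_central : central h;
  hc_h_skew : skew_primitive H 1 z h;
  hc_z_pm : z = yp * ym;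
  hc_z_mp : z = ym * yp;
  hc_yp : central_grouplike H yp;
  hc_ym : central_grouplike H ym;
  hc_chi : chi yp = chi ym;
  hc_winding : winding_l H chi =1 ad_l H yp \o winding_r H chi
}.

(* D is the triple (sigma, h, xi) with sigma = tau^l_chi and xi = chi(yp). *)
Definition data_of (k : fieldType) (R : algType k) (H : hopf R)
    (chi : {lrmorphism R -> k^o}) (h yp : R) (D : ambiskew_data R) : Prop :=
  [/\ as_sigma D =1 winding_l H chi, as_h D = h & as_xi D = chi yp].

(* Main.v *)
Require Import Defs.
From HB Require Import structures.
From mathcomp Require Import all_boot all_algebra.
From mathcomp Require Import boolp functions.

Set Implicit Arguments.
Unset Strict Implicit.
Unset Printing Implicit Defensive.

Import GRing.Theory.
Local Open Scope ring_scope.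

(* (i) The coproduct, the counit and the antipode of A are obtained from the universal
   property of the presentation, the last one with values in the opposite algebra. With
   sigma = tau^l_chi = ad(y_+) tau^r_chi, compatibility with X_+ r = sigma(r) X_+ amounts to
     Delta (sigma r) = (sigma ⊗ 1) (Delta r)   and
     Delta (sigma r) (y_+ ⊗ 1) = (y_+ ⊗ 1) (1 ⊗ sigma) (Delta r)
   for the coproduct, and to sigma S sigma = ad(y_+) S for the antipode.

   (ii) The monomials 1, X_+, X_-, X_- X_+ are linearly independent over R. Comparing
   coefficients in coassociativity makes r_± and l_± grouplike; in the coproduct of
   X_± r = sigma_±(r) X_± it gives back the two identities above; and in the coproduct of
   X_+ X_- = a + b X_- X_+ it makes b a scalar and a skew primitive, and shows that
   sigma_+(y_-) = b y_- and y_+ = b sigma_-(y_+). Finally sigma_+ sigma_- is both inner and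
   a winding automorphism whose character is eps, hence trivial. *)

(** In (i) the assumption on [sigma] is stated with y_+ only. What X_- needs is the inverse of the
    identity for X_+, and centrality of z = y_+ y_- turns conjugation by y_+^-1 into conjugation by
    y_-. Bijectivity of the antipode of A is a separate matter: S^2 multiplies X_+ by xi and X_- by
    xi^-1, so the inverse comes from the inverse antipode of R by the same construction with
    rescaled variables. In (ii) the change of variables alone does not yield an ambiskew
    presentation. The automorphisms attached to the two new variables are not visibly inverse to
    each other, the coefficient of X_- X_+ is only an element of R, and the new h is the old one
    times a unit not known to be central. The Hopf structure repairs each of these; once sigma_+
    sigma_- = id, the unit is central, and so is z. Since A ⊗ A is here only a ring, the universal
    property is stated for maps f into bare rings, the scalar xi being carried by f(xi 1). *)

Section TensorMaps.
Variable k : fieldType.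
Implicit Types U V W : lmodType k.

Lemma linear_tlift V W U U' (G : {linear U -> U'}) (f : V -> W -> U) x :
  G (tlift f x) = tlift (fun v w => G (f v w)) x.
Proof. exact: raddf_sum. Qed.

Lemma eq_tlift V W U (f g : V -> W -> U) : f =2 g -> tlift f =1 tlift g.
Proof. by move=> fg x; apply: eq_bigr => p _; apply: fg. Qed.

Lemma tmap_bilinear V W V' W' (f : {linear V -> V'}) (g : {linear W -> W'}) :
  bilinear_map (fun v w => f v ⊗ g w).
Proof.
by split=> [w c x y|v c x y]; rewrite linearP ?tensDl ?tensDr ?tensZl ?tensZr.
Qed.

Lemma tmap_tens V W V' W' (f : {linear V -> V'}) (g : {linear W -> W'}) v w :
  tmap f g (v ⊗ w) = f v ⊗ g w.
Proof. exact: (tlift_tens (tmap_bilinear f g)). Qed.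

Lemma tmap_linear V W V' W' (f : {linear V -> V'}) (g : {linear W -> W'}) :
  linear (tmap f g).
Proof. exact: (tlift_linear (tmap_bilinear f g)). Qed.

HB.instance Definition _ V W V' W' (f : {linear V -> V'}) (g : {linear W -> W'}) :=
  GRing.isLinear.Build k _ _ _ (tmap f g) (tmap_linear f g).

Lemma tens0l V W (w : W) : (0 : V) ⊗ w = 0.
Proof. by rewrite -[X in X ⊗ _](scale0r 0) tensZl scale0r. Qed.

Lemma tens0r V W (v : V) : v ⊗ (0 : W) = 0.
Proof. by rewrite -[X in _ ⊗ X](scale0r 0) tensZr scale0r. Qed.

(* Carrying the linearity proof makes an arbitrary map, such as [tlift f], a {linear}. *)
Definition of_linear V W (f : V -> W) (_ : linear f) := f.

HB.instance Definition _ V W (f : V -> W) (fl : linear f) :=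
  GRing.isLinear.Build k V W _ (of_linear fl) fl.

Lemma tlift_tmap V W V' W' U (f : {linear V -> V'}) (g : {linear W -> W'})
    (F : V' -> W' -> U) (F_bil : bilinear_map F) x :
  tlift F (tmap f g x) = tlift (fun v w => F (f v) (g w)) x.
Proof.
rewrite [RHS](eq_tlift (g := fun v w => tlift F (f v ⊗ g w))); last first.
  by move=> v w; rewrite tlift_tens.
by rewrite -[LHS]/(of_linear (tlift_linear F_bil) _) [LHS]linear_tlift.
Qed.

Lemma tmap_comp V W V' W' V'' W'' (f : {linear V -> V'}) (g : {linear W -> W'})
    (f' : {linear V' -> V''}) (g' : {linear W' -> W''}) x :
  tmap f' g' (tmap f g x) = tmap (f' \o f) (g' \o g) x.
Proof. exact: (tlift_tmap _ _ (tmap_bilinear f' g')). Qed.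

Lemma eq_tmap V W V' W' (f f' : V -> V') (g g' : W -> W') :
  f =1 f' -> g =1 g' -> tmap f g =1 tmap f' g'.
Proof. by move=> ff' gg'; apply: eq_tlift => v w; rewrite ff' gg'. Qed.

Lemma tmap_id V W (x : V ⊗ W) : tmap idfun idfun x = x.
Proof. by elim/tensor_ind: x => [v w||x y]; rewrite ?tmap_tens ?linear0 // linearD /= => -> ->. Qed.

Lemma tlift_linear_arg U V W U' (f : U -> V -> W -> U') x :
  (forall v w, linear (fun u => f u v w)) -> linear (fun u => tlift (f u) x).
Proof.
move=> fl c u u'; rewrite /tlift scaler_sumr -big_split /=.
by apply: eq_bigr => p _; apply: fl.
Qed.

Lemma exchange_tlift V W V' W' U (f : V -> W -> V' -> W' -> U) x y :
  tlift (fun v w => tlift (fun v' w' => f v w v' w') y) x =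
  tlift (fun v' w' => tlift (fun v w => f v w v' w') x) y.
Proof. exact: exchange_big. Qed.

Lemma tlift_tens_id V W (x : (V ⊗ W)%type) : tlift (fun v w => v ⊗ w) x = x.
Proof. exact: tmap_id. Qed.

Lemma tassoc_bilinear U V W :
  bilinear_map (fun (y : (U ⊗ V)%type) (w : W) => tlift (fun u v => u ⊗ (v ⊗ w)) y).
Proof.
have bil w : bilinear_map (fun (u : U) (v : V) => u ⊗ (v ⊗ w)).
  by split=> [u|u] c x1 x2; rewrite ?(tensDl, tensZl, tensDr, tensZr).
split=> [w|y] c x1 x2; first exact: tlift_linear.
elim/tensor_ind: y => [u v||u v] /=.
- by rewrite !tlift_tens // !(tensDr, tensZr).
- by rewrite !tlift0 // scaler0 addr0.
- by rewrite !tliftD // => -> ->; rewrite scalerDr addrACA.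
Qed.

Lemma tassoc_tens U V W (u : U) (v : V) (w : W) :
  tassoc ((u ⊗ v) ⊗ w) = u ⊗ (v ⊗ w).
Proof.
rewrite /tassoc (tlift_tens (tassoc_bilinear U V W)) tlift_tens //.
by split=> x c y t; rewrite ?(tensDl, tensZl, tensDr, tensZr).
Qed.

HB.instance Definition _ U V W :=
  GRing.isLinear.Build k _ _ _ (@tassoc k U V W) (tlift_linear (tassoc_bilinear U V W)).

Lemma tassoc_tmap U V W U' V' W' (f : {linear U -> U'}) (g : {linear V -> V'})
    (l : {linear W -> W'}) x :
  tassoc (tmap (tmap f g) l x) = tmap f (tmap g l) (tassoc x).
Proof.
elim/tensor_ind: x => [y w||x y IH IH']; first last.
- by rewrite !linearD /= IH IH'.
- by rewrite !linear0.
elim/tensor_ind: y => [u v||x y IH IH']; first last.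
- by rewrite tensDl !linearD /= IH IH'.
- by rewrite tens0l !linear0.
by rewrite tassoc_tens !tmap_tens /= !tmap_tens tassoc_tens.
Qed.

End TensorMaps.

(** * Multiplicative maps out of a tensor product of algebras *)

Section TensorRing.
Variables (k : fieldType) (A B : algType k).
Implicit Types x y : (A ⊗ B)%type.

Lemma tens_scaleAl (c : k) x y : c *: (x * y) = (c *: x) * y.
Proof.
elim/tensor_ind: x => [a b||x x' IH IH']; first last.
- by rewrite scalerDr !mulrDl scalerDr IH IH'.
- by rewrite mul0r !scaler0 mul0r.
elim/tensor_ind: y => [a' b'||y y' IH IH']; first last.
- by rewrite !mulrDr scalerDr IH IH'.
- by rewrite !mulr0 scaler0.
by rewrite -tensZl !tens_mul -scalerAl tensZl.
Qed.

Lemma tens_scaleAr (c : k) x y : c *: (x * y) = x * (c *: y).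
Proof.
elim/tensor_ind: x => [a b||x x' IH IH']; first last.
- by rewrite !mulrDl scalerDr IH IH'.
- by rewrite !mul0r scaler0.
elim/tensor_ind: y => [a' b'||y y' IH IH']; first last.
- by rewrite scalerDr !mulrDr scalerDr IH IH'.
- by rewrite mulr0 !scaler0 mulr0.
by rewrite -tensZl !tens_mul -scalerAr tensZl.
Qed.

Lemma tensor_morphM (U : pzRingType) (f : {additive (A ⊗ B)%type -> U}) :
    (forall a b a' b', f ((a * a') ⊗ (b * b')) = f (a ⊗ b) * f (a' ⊗ b')) ->
  {morph f : x y / x * y}.
Proof.
move=> fM x y; elim/tensor_ind: x => [a b||x x' IH IH']; first last.
- by rewrite mulrDl !raddfD mulrDl IH IH'.
- by rewrite mul0r !raddf0 mul0r.
elim/tensor_ind: y => [a' b'||y y' IH IH']; first last.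
- by rewrite mulrDr !raddfD mulrDr IH IH'.
- by rewrite mulr0 !raddf0 mulr0.
by rewrite tens_mul fM.
Qed.

Lemma tlift_mul (U : lalgType k) (f : A -> B -> U) :
    bilinear_map f ->
    (forall a b a' b', f (a * a') (b * b') = f a b * f a' b') ->
  {morph tlift f : x y / x * y}.
Proof.
move=> fb fM; apply: (tensor_morphM (f := of_linear (tlift_linear fb))) => a b a' b'.
rewrite -[LHS]/(tlift f _) -[RHS]/(tlift f _ * tlift f _).
by rewrite !tlift_tens.
Qed.

Lemma tmap_mul (A' B' : algType k) (f : {lrmorphism A -> A'}) (g : {lrmorphism B -> B'}) :
  {morph tmap f g : x y / x * y}.
Proof.
apply: (tensor_morphM (f := tmap f g)) => a b a' b'.
by rewrite /= !tmap_tens !rmorphM tens_mul.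
Qed.

Lemma tlift_tensM (U : lmodType k) (f : A -> B -> U) x y : bilinear_map f ->
  tlift f (x * y) = tlift (fun a b => tlift (fun a' b' => f (a * a') (b * b')) y) x.
Proof.
move=> fb; rewrite -[LHS]/(of_linear (tlift_linear fb) _) [LHS]linear_tlift.
apply: eq_tlift => a b; rewrite [LHS]linear_tlift; apply: eq_tlift => a' b'.
exact: tlift_tens.
Qed.

End TensorRing.

(** * Coassociativity on products *)

Section TripleTensor.
Variables (k : fieldType) (A : algType k).

(* A ⊗ A carries no algType structure, so that the product of A ⊗ (A ⊗ A) is not an
   instance of the product of a tensor product of algebras. *)
Definition mul3 (x y : (A ⊗ (A ⊗ A))%type) : (A ⊗ (A ⊗ A))%type :=
  tlift (fun (a : A) (u : (A ⊗ A)%type) =>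
    tlift (fun (a' : A) (u' : (A ⊗ A)%type) => (a * a') ⊗ (u * u')) y) x.

Let bilin_inner (a : A) (u : (A ⊗ A)%type) :
  bilinear_map (fun (a' : A) (u' : (A ⊗ A)%type) => (a * a') ⊗ (u * u')).
Proof.
split=> x c y t; first by rewrite mulrDr -scalerAr tensDl tensZl.
by rewrite mulrDr -tens_scaleAr tensDr tensZr.
Qed.

Let bilin_outer (y : (A ⊗ (A ⊗ A))%type) :
  bilinear_map (fun (a : A) (u : (A ⊗ A)%type) =>
    tlift (fun (a' : A) (u' : (A ⊗ A)%type) => (a * a') ⊗ (u * u')) y).
Proof.
split=> x c s t; elim/tensor_ind: y => [v w||u v] /=.
- by rewrite !(tlift_tens (bilin_inner _ _)) mulrDl -scalerAl tensDl tensZl.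
- by rewrite !(tlift0 (bilin_inner _ _)) scaler0 addr0.
- by rewrite !(tliftD (bilin_inner _ _)) => -> ->; rewrite scalerDr addrACA.
- by rewrite !(tlift_tens (bilin_inner _ _)) mulrDl -tens_scaleAl tensDr tensZr.
- by rewrite !(tlift0 (bilin_inner _ _)) scaler0 addr0.
- by rewrite !(tliftD (bilin_inner _ _)) => -> ->; rewrite scalerDr addrACA.
Qed.

Lemma mul3_tens (a a' : A) (u u' : (A ⊗ A)%type) :
  mul3 (a ⊗ u) (a' ⊗ u') = (a * a') ⊗ (u * u').
Proof. by rewrite /mul3 (tlift_tens (bilin_outer _)) (tlift_tens (bilin_inner _ _)). Qed.

Lemma mul3Dl x y z : mul3 (x + y) z = mul3 x z + mul3 y z.
Proof. exact: (tliftD (bilin_outer z)). Qed.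

Lemma mul3Dr x y z : mul3 x (y + z) = mul3 x y + mul3 x z.
Proof.
elim/tensor_ind: x => [a u||x x' IH IH']; last by rewrite !mul3Dl IH IH' addrACA.
  by rewrite /mul3 !(tlift_tens (bilin_outer _)) (tliftD (bilin_inner _ _)).
by rewrite /mul3 !(tlift0 (bilin_outer _)) addr0.
Qed.

Lemma mul30l x : mul3 0 x = 0.
Proof. exact: (tlift0 (bilin_outer x)). Qed.

Lemma mul3x0 x : mul3 x 0 = 0.
Proof. by apply: (addrI (mul3 x 0)); rewrite -mul3Dr !addr0. Qed.

Lemma tensor_morph_mul3 (U V : algType k)
    (f : {additive (U ⊗ V)%type -> (A ⊗ (A ⊗ A))%type}) :
    (forall a b a' b', f ((a ⊗ b) * (a' ⊗ b')) = mul3 (f (a ⊗ b)) (f (a' ⊗ b'))) ->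
  {morph f : x y / x * y >-> mul3 x y}.
Proof.
move=> fM x y; elim/tensor_ind: x => [a b||x x' IH IH']; first last.
- by rewrite mulrDl !raddfD mul3Dl IH IH'.
- by rewrite mul0r !raddf0 mul30l.
elim/tensor_ind: y => [a' b'||y y' IH IH'] //.
- by rewrite mulr0 !raddf0 mul3x0.
- by rewrite mulrDr !raddfD mul3Dr IH IH'.
Qed.

Variable d : {linear A -> (A ⊗ A)%type}.
Hypothesis dM : {morph d : a b / a * b}.

Lemma tassocM (u u' : (A ⊗ A)%type) (b b' : A) :
  tassoc ((u * u') ⊗ (b * b')) = mul3 (tassoc (u ⊗ b)) (tassoc (u' ⊗ b')).
Proof.
elim/tensor_ind: u => [a1 a2||u v IH IH']; first last.
- by rewrite mulrDl !tensDl !linearD /= mul3Dl IH IH'.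
- by rewrite mul0r !tens0l !linear0 /= mul30l.
elim/tensor_ind: u' => [a1' a2'||u v IH IH']; first last.
- by rewrite mulrDr !tensDl !linearD /= mul3Dr IH IH'.
- by rewrite mulr0 !tens0l !linear0 /= mul3x0.
by rewrite tens_mul !tassoc_tens mul3_tens tens_mul.
Qed.

(** Both sides are multiplicative for [mul3], so the elements at which coassociativity holds are
    closed under products, and for an ambiskew algebra the generators suffice. *)
Lemma coassoc_mul a b :
    tassoc (tmap d idfun (d a)) = tmap idfun d (d a) ->
    tassoc (tmap d idfun (d b)) = tmap idfun d (d b) ->
  tassoc (tmap d idfun (d (a * b))) = tmap idfun d (d (a * b)).
Proof.
move=> ha hb; rewrite dM.
rewrite [LHS](@tensor_morph_mul3 _ _ (@tassoc k A A A \o tmap d idfun)) /=; last first.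
  by move=> a1 b1 a2 b2; rewrite /= tens_mul !tmap_tens dM tassocM.
rewrite ha hb -(@tensor_morph_mul3 _ _ (tmap idfun d)) //.
by move=> a1 b1 a2 b2; rewrite /= tens_mul !tmap_tens dM mul3_tens.
Qed.

End TripleTensor.

(** * Moving elements of R ⊗ R to the left of a skew variable *)

Section SkewTensors.
Variables (k : fieldType) (R A : algType k) (i : {lrmorphism R -> A}) (X : A).
Variable s : {linear R -> R}.
Hypothesis Xi : forall r, X * i r = i (s r) * X.

(** This lemma and the next two bring products to the normal form (element of R ⊗ R) times X ⊗ 1 or
    1 ⊗ X, in which coefficients can be compared. *)
Lemma skew_tensl t : (X ⊗ 1) * tmap i i t = tmap i i (tmap s idfun t) * (X ⊗ 1).
Proof.
elim/tensor_ind: t => [a b||x y IH IH']; first last.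
- by rewrite !linearD mulrDr mulrDl IH IH'.
- by rewrite !linear0 mulr0 mul0r.
by rewrite !tmap_tens !tens_mul Xi mul1r mulr1.
Qed.

Lemma skew_tensr y t :
  (i y ⊗ X) * tmap i i t = tmap i i ((y ⊗ 1) * tmap idfun s t) * (1 ⊗ X).
Proof.
elim/tensor_ind: t => [a b||u v IH IH']; first last.
- by rewrite !(linearD, mulrDr) mulrDl IH IH'.
- by rewrite !(linear0, mulr0) mul0r.
by rewrite !(tmap_tens, tens_mul) Xi rmorphM mul1r mulr1.
Qed.

Lemma coef_tensr y t : tmap i i t * (i y ⊗ X) = tmap i i (t * (y ⊗ 1)) * (1 ⊗ X).
Proof.
elim/tensor_ind: t => [a b||u v IH IH']; first last.
- by rewrite !(linearD, mulrDl) IH IH' -mulrDl.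
- by rewrite !(linear0, mul0r).
by rewrite !(tmap_tens, tens_mul) rmorphM !mulr1.
Qed.

End SkewTensors.

(** * The antipode axioms on products *)

Section AntiMultiplicative.
Variables (k : fieldType) (A : algType k).

Variable S : {linear A -> A}.
Lemma mul_antil_bilinear : bilinear_map (fun a b => S a * b).
Proof.
split=> x c u v; first by rewrite linearP mulrDl scalerAl.
by rewrite mulrDr scalerAr.
Qed.

Lemma mul_antir_bilinear : bilinear_map (fun a b => a * S b).
Proof.
split=> x c u v; first by rewrite mulrDl scalerAl.
by rewrite linearP mulrDr scalerAr.
Qed.

Hypothesis SM : forall a b, S (a * b) = S b * S a.

(** S(a a') b b' = S(a') (S(a) b) b': the sum over [x] collapses to the scalar c inside the sum over
    [y]. *)
Lemma mul_antil_mul (x y : (A ⊗ A)%type) c d :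
    tlift (fun a b => S a * b) x = c *: 1 -> tlift (fun a b => S a * b) y = d *: 1 ->
  tlift (fun a b => S a * b) (x * y) = (c * d) *: 1.
Proof.
move=> hx hy; rewrite tlift_tensM; last exact: mul_antil_bilinear.
rewrite exchange_tlift -scalerA -hy [in RHS]/tlift scaler_sumr; apply: eq_bigr => p _.
rewrite [in RHS]scalerAr -[in RHS](mul1r p.2) (scalerAl c) -hx /tlift mulr_suml mulr_sumr.
by apply: eq_bigr => q _; rewrite SM !mulrA.
Qed.

Lemma mul_antir_mul (x y : (A ⊗ A)%type) c d :
    tlift (fun a b => a * S b) x = c *: 1 -> tlift (fun a b => a * S b) y = d *: 1 ->
  tlift (fun a b => a * S b) (x * y) = (c * d) *: 1.
Proof.
move=> hx hy; rewrite tlift_tensM; last exact: mul_antir_bilinear.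
rewrite mulrC -scalerA -hx [in RHS]/tlift scaler_sumr; apply: eq_bigr => p _.
rewrite [in RHS]scalerAr -[in RHS](mul1r (S p.2)) (scalerAl d) -hy /tlift mulr_suml mulr_sumr.
by apply: eq_bigr => q _; rewrite SM !mulrA.
Qed.

End AntiMultiplicative.

(** * Sweedler calculus and the antipode as an antimorphism *)

Section HopfAlgebra.
Variables (k : fieldType) (R : algType k) (H : hopf R).

Local Notation Delta := (hopf_comul H).
Local Notation eps := (hopf_counit H).
Local Notation S := (hopf_antipode H).

Lemma comul1 : Delta 1 = 1 ⊗ 1.
Proof. by have [-> _] := hopf_comul_mult H. Qed.

Lemma comulM : {morph Delta : a b / a * b}.
Proof. by have [] := hopf_comul_mult H. Qed.

Definition trilinear_map (U : lmodType k) (F : R -> R -> R -> U) :=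
  [/\ forall b c, linear (fun a => F a b c), forall a c, linear (fun b => F a b c) &
      forall a b, linear (F a b)].

(** Coassociativity in Sweedler form, applicable to any trilinear expression in the three
    components. *)
Lemma coassoc_tlift (U : lmodType k) (F : R -> R -> R -> U) a :
    trilinear_map F ->
  tlift (fun a1 a2 => tlift (fun a11 a12 => F a11 a12 a2) (Delta a1)) (Delta a) =
  tlift (fun a1 a2 => tlift (fun a21 a22 => F a1 a21 a22) (Delta a2)) (Delta a).
Proof.
move=> [F1 F2 F3].
have b3 (a1 : R) : bilinear_map (F a1) by split=> [c|b] x u v; rewrite (F2, F3).
have b2 : bilinear_map (fun a1 => tlift (F a1)).
  split=> [u|a1] c x y; last exact: (tlift_linear (b3 a1)).
  elim/tensor_ind: u => [v w||u v] /=; first by rewrite !tlift_tens // F1.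
  - by rewrite !tlift0 // scaler0 addr0.
  - by rewrite !tliftD // => -> ->; rewrite scalerDr addrACA.
pose G : {linear (R ⊗ (R ⊗ R))%type -> U} := of_linear (tlift_linear b2).
transitivity (G (tassoc (tmap Delta idfun (Delta a)))).
  rewrite /tassoc tlift_tmap; last first.
    exact: tassoc_bilinear.
  rewrite [G _]linear_tlift; apply: eq_tlift => a1 a2.
  rewrite [G _]linear_tlift; apply: eq_tlift => u v.
  by rewrite -[RHS]/(tlift (fun a1 => tlift (F a1)) _) !tlift_tens.
rewrite hopf_coassoc.
have -> : G =1 tlift (fun a1 => tlift (F a1)) by [].
rewrite (tlift_tmap _ _ b2); exact: eq_tlift.
Qed.

Lemma eps_tliftl (U : lmodType k) (f : R -> U) a :
  linear f -> tlift (fun a1 a2 => eps a1 *: f a2) (Delta a) = f a.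
Proof.
move=> fl; rewrite -[in RHS](hopf_counitl H a) -[RHS]/(of_linear fl _) linear_tlift.
by apply: eq_tlift => a1 a2; rewrite linearZ.
Qed.

Lemma eps_tliftr (U : lmodType k) (f : R -> U) a :
  linear f -> tlift (fun a1 a2 => eps a2 *: f a1) (Delta a) = f a.
Proof.
move=> fl; rewrite -[in RHS](hopf_counitr H a) -[RHS]/(of_linear fl _) linear_tlift.
by apply: eq_tlift => a1 a2; rewrite linearZ.
Qed.

(* Convolution inverses are unique: g = g * (rho * f) = (g * rho) * f. *)
Lemma convolution_unique (A : algType k) (g rho f : R -> A) (u : A) :
    linear g -> linear rho -> linear f ->
    (forall a, tlift (fun a1 a2 => g a1 * rho a2) (Delta a) = eps a *: u) ->
    (forall a, tlift (fun a1 a2 => rho a1 * f a2) (Delta a) = eps a *: 1) ->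
  forall a, g a = u * f a.
Proof.
move=> gl rl fl gr rf a; rewrite -(eps_tliftr a gl).
transitivity (tlift (fun a1 a2 =>
    tlift (fun a21 a22 => g a1 * rho a21 * f a22) (Delta a2)) (Delta a)).
  apply: eq_tlift => a1 a2; rewrite -[in LHS](mulr1 (g a1)) scalerAr -rf.
  rewrite /tlift mulr_sumr; apply: eq_bigr => p _; exact: mulrA.
rewrite -(coassoc_tlift (F := fun x y z => g x * rho y * f z)); last first.
  by split=> x y c z t; rewrite ?(gl, rl, fl) ?(mulrDl, mulrDr) -?(scalerAl, scalerAr).
rewrite -[in RHS](eps_tliftl a fl) [in RHS]/tlift mulr_sumr; apply: eq_bigr => p _ /=.
rewrite [LHS](_ : _ = eps p.1 *: u * f p.2).
  by rewrite -scalerAl scalerAr.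
by rewrite -gr [in RHS]/tlift mulr_suml.
Qed.

Lemma antipode_linear_mul (u : R) : linear (fun a => S (a * u)).
Proof. by move=> c x y; rewrite mulrDl -scalerAl linearP. Qed.

(** Uniqueness of convolution inverses is used twice: in a with b fixed, which asks for sum S(a1 b)
    a2 = eps(a) S(b), and then in b with a fixed, where the sum becomes the antipode axiom at a
    b. *)
Lemma antipodeM a b : S (a * b) = S b * S a.
Proof.
have idl : linear (@idfun R) by [].
have Sl : linear S by move=> c x y; rewrite linearP.
apply: (@convolution_unique R (fun a => S (a * b)) idfun S (S b)) => //;
  [exact: antipode_linear_mul | move=> {}a | exact: hopf_antipoder].
pose g x := tlift (fun a1 a2 => S (a1 * x) * a2) (Delta a).
rewrite -[LHS]/(g b).
have gl : linear g.
  apply: tlift_linear_arg => v w c x y.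
  by rewrite mulrDr -scalerAr linearP mulrDl scalerAl.
rewrite (convolution_unique (rho := idfun) (f := S) (u := eps a *: 1) gl) //.
- by rewrite -scalerAl mul1r.
- move=> {}b; rewrite /g.
  transitivity (tlift (fun x y => S x * y) (Delta (a * b))).
    rewrite comulM tlift_tensM; last exact: mul_antil_bilinear.
    rewrite exchange_tlift; apply: eq_tlift => b1 b2; rewrite /tlift mulr_suml.
    by apply: eq_bigr => p _; rewrite mulrA.
  by rewrite hopf_antipodel rmorphM mulrC scalerA.
- exact: hopf_antipoder.
Qed.

Lemma antipode1 : S 1 = 1.
Proof.
have := hopf_antipodel H 1; rewrite comul1 rmorph1 tlift_tens ?mulr1 ?scale1r //.
exact: mul_antil_bilinear.
Qed.

End HopfAlgebra.

(** * Winding automorphisms and characters *)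

Section Winding.
Variables (k : fieldType) (R : algType k) (H : hopf R).
Implicit Types chi psi : {lrmorphism R -> k^o}.

Local Notation Delta := (hopf_comul H).
Local Notation eps := (hopf_counit H).
Local Notation S := (hopf_antipode H).

Lemma charP chi c a b : chi (c *: a + b) = c * chi a + chi b.
Proof. exact: linearP. Qed.

Lemma winding_l_bilinear chi : bilinear_map (fun a1 a2 : R => chi a1 *: a2).
Proof.
split=> a c u v; first by rewrite charP scalerDl scalerA.
by rewrite scalerDr !scalerA mulrC.
Qed.

Lemma winding_r_bilinear chi : bilinear_map (fun a1 a2 : R => chi a2 *: a1).
Proof.
split=> a c u v; last by rewrite charP scalerDl scalerA.
by rewrite scalerDr !scalerA mulrC.
Qed.

Lemma winding_l_linear chi : linear (winding_l H chi).
Proof.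
by move=> c a b; rewrite /winding_l linearP (tlift_linear (winding_l_bilinear chi)).
Qed.

Lemma winding_r_linear chi : linear (winding_r H chi).
Proof.
by move=> c a b; rewrite /winding_r linearP (tlift_linear (winding_r_bilinear chi)).
Qed.

HB.instance Definition _ chi :=
  GRing.isLinear.Build k R R _ (winding_l H chi) (winding_l_linear chi).
HB.instance Definition _ chi :=
  GRing.isLinear.Build k R R _ (winding_r H chi) (winding_r_linear chi).

Lemma winding_l_monoid chi : monoid_morphism (winding_l H chi).
Proof.
split=> [|a b]; rewrite /winding_l.
  by rewrite comul1 (tlift_tens (winding_l_bilinear chi)) rmorph1 scale1r.
rewrite comulM tlift_mul //; first exact: winding_l_bilinear.
by move=> a1 a2 b1 b2; rewrite rmorphM -scalerAl -scalerAr scalerA.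
Qed.

Lemma winding_r_monoid chi : monoid_morphism (winding_r H chi).
Proof.
split=> [|a b]; rewrite /winding_r.
  by rewrite comul1 (tlift_tens (winding_r_bilinear chi)) rmorph1 scale1r.
rewrite comulM tlift_mul //; first exact: winding_r_bilinear.
by move=> a1 a2 b1 b2; rewrite rmorphM -scalerAl -scalerAr scalerA.
Qed.

HB.instance Definition _ chi :=
  GRing.isMonoidMorphism.Build R R (winding_l H chi) (winding_l_monoid chi).
HB.instance Definition _ chi :=
  GRing.isMonoidMorphism.Build R R (winding_r H chi) (winding_r_monoid chi).

Lemma comul_winding_l chi a : Delta (winding_l H chi a) = tmap (winding_l H chi) idfun (Delta a).
Proof.
rewrite linear_tlift.
rewrite (eq_tlift (g := fun a1 a2 =>
    tlift (fun u v => (chi a1 : k) *: (u ⊗ v)) (Delta a2))); last first.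
  by move=> u v; rewrite linearZ -[in LHS](tlift_tens_id (Delta v)) [LHS]linear_tlift.
rewrite -(@coassoc_tlift _ _ _ _ (fun x y z => (chi x : k) *: (y ⊗ z))); last first.
  split=> x y c z t; first by rewrite charP scalerDl scalerA.
    by rewrite tensDl tensZl scalerDr !scalerA mulrC.
  by rewrite tensDr tensZr scalerDr !scalerA mulrC.
apply: eq_tlift => u v.
rewrite -[RHS]/((fun x => x ⊗ v) (winding_l H chi u)).
by rewrite /winding_l /tlift; elim/big_rec2: _ => [|p x y _ ->]; rewrite ?tens0l // tensDl tensZl.
Qed.

Lemma comul_winding_r chi a : Delta (winding_r H chi a) = tmap idfun (winding_r H chi) (Delta a).
Proof.
rewrite linear_tlift.
rewrite (eq_tlift (g := fun a1 a2 =>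
    tlift (fun u v => (chi a2 : k) *: (u ⊗ v)) (Delta a1))); last first.
  by move=> u v; rewrite linearZ -[in LHS](tlift_tens_id (Delta u)) [LHS]linear_tlift.
rewrite (@coassoc_tlift _ _ _ _ (fun x y z => (chi z : k) *: (x ⊗ y))); last first.
  split=> x y c z t; last by rewrite charP scalerDl scalerA.
    by rewrite tensDl tensZl scalerDr !scalerA mulrC.
  by rewrite tensDr tensZr scalerDr !scalerA mulrC.
apply: eq_tlift => u v.
rewrite -[RHS]/((fun x => u ⊗ x) (winding_r H chi v)).
by rewrite /winding_r /tlift; elim/big_rec2: _ => [|p x y _ ->]; rewrite ?tens0r // tensDr tensZr.
Qed.

(** Both sides are sum a1 chi(a2) ⊗ a3 for the iterated coproduct a1 ⊗ a2 ⊗ a3. *)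
Lemma tmap_winding chi a :
  tmap (winding_r H chi) idfun (Delta a) = tmap idfun (winding_l H chi) (Delta a).
Proof.
rewrite /tmap.
transitivity (tlift (fun a1 a2 => tlift (fun u v => (chi v : k) *: (u ⊗ a2))
    (Delta a1)) (Delta a)).
  apply: eq_tlift => u v; rewrite -[LHS]/((fun x => x ⊗ v) (winding_r H chi u)).
  by rewrite /winding_r /tlift; elim/big_rec2: _ => [|p x y _ <-]; rewrite ?tens0l // tensDl tensZl.
rewrite (@coassoc_tlift _ _ _ _ (fun x y z => (chi y : k) *: (x ⊗ z))); last first.
  split=> x y c z t; first by rewrite tensDl tensZl scalerDr !scalerA mulrC.
    by rewrite charP scalerDl scalerA.
  by rewrite tensDr tensZr scalerDr !scalerA mulrC.
apply: eq_tlift => u v; rewrite -[RHS]/((fun x => u ⊗ x) (winding_l H chi v)).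
by rewrite /winding_l /tlift; elim/big_rec2: _ => [|p x y _ ->]; rewrite ?tens0r // tensDr tensZr.
Qed.

Lemma char_winding_l chi psi a :
  chi (winding_l H psi a) = tlift (fun a1 a2 => psi a1 * chi a2) (Delta a).
Proof. by rewrite linear_tlift; apply: eq_tlift => u v; rewrite linearZ. Qed.

Lemma char_winding_r chi psi a :
  chi (winding_r H psi a) = tlift (fun a1 a2 => chi a1 * psi a2) (Delta a).
Proof. by rewrite linear_tlift; apply: eq_tlift => u v; rewrite linearZ mulrC. Qed.

Lemma counit_winding_r chi a : eps (winding_r H chi a) = chi a.
Proof.
rewrite char_winding_r -[in RHS](hopf_counitl H a) linear_tlift.
by apply: eq_tlift => u v; rewrite linearZ.
Qed.

(** The composite is the left winding map of the convolution product of [psi] and [chi], which the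
    hypothesis makes equal to eps. *)
Lemma winding_lK chi psi :
    (forall a, tlift (fun a1 a2 => psi a1 * chi a2) (Delta a) = eps a) ->
  cancel (winding_l H psi) (winding_l H chi).
Proof.
move=> psichi a; rewrite {1}/winding_l comul_winding_l tlift_tmap; last exact: winding_l_bilinear.
rewrite -[RHS](hopf_counitl H); apply: eq_tlift => u v /=.
by rewrite char_winding_l psichi.
Qed.

Lemma winding_rK chi psi :
    (forall a, tlift (fun a1 a2 => chi a1 * psi a2) (Delta a) = eps a) ->
  cancel (winding_r H psi) (winding_r H chi).
Proof.
move=> psichi a; rewrite {1}/winding_r comul_winding_r tlift_tmap; last exact: winding_r_bilinear.
rewrite -[RHS](hopf_counitr H); apply: eq_tlift => u v /=.
by rewrite char_winding_r psichi.
Qed.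

(** The inverse of [chi] in the group of characters under convolution. It is multiplicative although
    S reverses products, because k is commutative. *)
Definition char_inv chi : R -> k^o := chi \o S.

HB.instance Definition _ chi := GRing.Linear.on (char_inv chi).

Lemma char_inv_monoid chi : monoid_morphism (char_inv chi).
Proof.
split=> [|a b]; rewrite /char_inv /= ?antipode1 ?rmorph1 //.
by rewrite antipodeM rmorphM mulrC.
Qed.

HB.instance Definition _ chi :=
  GRing.isMonoidMorphism.Build R k^o (char_inv chi) (char_inv_monoid chi).

Lemma char_invr chi a : tlift (fun a1 a2 => chi a1 * char_inv chi a2) (Delta a) = eps a.
Proof.
transitivity (chi (eps a *: 1)); last by rewrite linearZ rmorph1; apply: mulr1.
rewrite -hopf_antipoder linear_tlift; apply: eq_tlift => u v.
by rewrite rmorphM.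
Qed.

Lemma char_invl chi a : tlift (fun a1 a2 => char_inv chi a1 * chi a2) (Delta a) = eps a.
Proof.
transitivity (chi (eps a *: 1)); last by rewrite linearZ rmorph1; apply: mulr1.
rewrite -hopf_antipodel linear_tlift; apply: eq_tlift => u v.
by rewrite rmorphM.
Qed.

(* Both sides are convolution inverses of the algebra map [winding_r (chi o S)]. *)
Lemma antipode_winding_l chi a :
  S (winding_l H chi a) = winding_r H (char_inv chi) (S a).
Proof.
rewrite -[RHS]mul1r.
apply: (@convolution_unique _ _ _ _ (fun a => S (winding_l H chi a)) (winding_r H (char_inv chi))
   (fun a => winding_r H (char_inv chi) (S a)) 1) => [c u v|c u v|c u v|{}a|{}a];
  rewrite ?linearP //.
- rewrite -(tlift_tmap _ _ (mul_antil_bilinear S)).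
  rewrite [X in tlift _ X](_ : _ = Delta (winding_r H (char_inv chi) (winding_l H chi a))).
    by rewrite hopf_antipodel counit_winding_r char_winding_l char_invr.
  by rewrite comul_winding_r comul_winding_l tmap_comp; apply: eq_tmap.
- transitivity (winding_r H (char_inv chi) (eps a *: 1)); last by rewrite linearZ rmorph1.
  rewrite -hopf_antipoder linear_tlift; apply: eq_tlift => u v.
  by rewrite rmorphM.
Qed.

Lemma winding_l_grouplike chi g : grouplike H g -> winding_l H chi g = chi g *: g.
Proof. by case=> Dg _; rewrite /winding_l Dg (tlift_tens (winding_l_bilinear chi)). Qed.

Lemma winding_r_grouplike chi g : grouplike H g -> winding_r H chi g = chi g *: g.
Proof. by case=> Dg _; rewrite /winding_r Dg (tlift_tens (winding_r_bilinear chi)). Qed.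

Lemma grouplike_inv g : grouplike H g -> inverse_of g (S g).
Proof.
case=> Dg eg; split.
  have := hopf_antipoder H g; rewrite Dg tlift_tens ?eg ?scale1r //.
  exact: mul_antir_bilinear.
have := hopf_antipodel H g; rewrite Dg tlift_tens ?eg ?scale1r //.
exact: mul_antil_bilinear.
Qed.

Lemma ad_l_grouplike g a : grouplike H g -> ad_l H g a = g * a * S g.
Proof.
case=> Dg _; rewrite /ad_l Dg tlift_tens //.
split=> x c u v; first by rewrite !mulrDl -!scalerAl.
by rewrite linearP mulrDr -scalerAr.
Qed.

Lemma char_grouplike_neq0 chi g : grouplike H g -> chi g != 0.
Proof.
case/grouplike_inv=> gS _; apply/eqP => chi0.
by have /eqP := congr1 chi gS; rewrite rmorphM rmorph1 /= chi0 mul0r eq_sym oner_eq0.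
Qed.

End Winding.

(** * Grouplike elements and left-invariant automorphisms *)

Section GrouplikeGroup.
Variables (k : fieldType) (R : algType k) (H : hopf R).

Lemma grouplikeM g g' : grouplike H g -> grouplike H g' -> grouplike H (g * g').
Proof.
move=> [Dg eg] [Dg' eg']; split; first by rewrite comulM Dg Dg' tens_mul.
by rewrite rmorphM /= eg eg'; apply: mulr1.
Qed.

Lemma grouplikeV g : grouplike H g -> grouplike H (hopf_antipode H g).
Proof.
move=> gg; have [gV Vg] := grouplike_inv gg; have [Dg eg] := gg.
set g' := hopf_antipode H g in gV Vg *; split.
  rewrite -[LHS]mulr1 tens_one -gV -tens_mul -Dg mulrA -comulM Vg comul1.
  by rewrite -tens_one mul1r.
have := congr1 (hopf_counit H) gV; rewrite rmorphM /= eg rmorph1 => e.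
by rewrite -[LHS]mul1r.
Qed.

(* A left-translation-invariant automorphism is the winding automorphism of a -> eps (s a). *)
Lemma left_invariant_winding (s : {lrmorphism R -> R}) :
    (forall a, hopf_comul H (s a) = tmap s idfun (hopf_comul H a)) ->
  forall a, s a = tlift (fun a1 a2 => (hopf_counit H (s a1) : k) *: a2) (hopf_comul H a).
Proof.
move=> Ds a; rewrite -[LHS](hopf_counitl H) Ds tlift_tmap //.
exact: winding_l_bilinear.
Qed.

Lemma left_invariant_id (s : {lrmorphism R -> R}) :
    (forall a, hopf_comul H (s a) = tmap s idfun (hopf_comul H a)) ->
    (forall a, hopf_counit H (s a) = hopf_counit H a) ->
  s =1 id.
Proof.
move=> Ds es a; rewrite (left_invariant_winding Ds) -[RHS](hopf_counitl H).
by apply: eq_tlift => u v; rewrite es.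
Qed.

End GrouplikeGroup.

(** * The universal property of the ambiskew algebra *)

Section AmbiskewModules.
Variables (k : fieldType) (R : algType k) (D : ambiskew_data R).

Local Notation sigma := (as_sigma D).
Local Notation sigmaV := (as_sigmaV D).
Local Notation h := (as_h D).
Local Notation xi := (as_xi D).

(** V is a mere additive group on which a scalar c acts as [rho c%:A], so that one notion covers
    coordinate arrays over R as well as left multiplication in A ⊗ A and in the opposite of A. *)
Record ambiskew_module (V : zmodType) (rho : R -> V -> V) (P M : V -> V) : Prop :=
  AmbiskewModule {
    am_addr : forall r, {morph rho r : v w / v + w};
    am_addP : {morph P : v w / v + w};
    am_addM : {morph M : v w / v + w};
    am_rhoD : forall r s v, rho (r + s) v = rho r v + rho s v;
    am_rhoM : forall r s v, rho (r * s) v = rho r (rho s v);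
    am_rho1 : forall v, rho 1 v = v;
    am_P : forall r v, P (rho r v) = rho (sigma r) (P v);
    am_M : forall r v, M (rho r v) = rho (sigmaV r) (M v);
    am_PM : forall v, P (M v) = rho h v + rho xi%:A (M (P v))
  }.

Fixpoint as_rep (V : zmodType) (rho : R -> V -> V) (P M : V -> V) (x : aterm R) : V -> V :=
  match x with
  | ACoef r => rho r
  | AXp => P
  | AXm => M
  | AAdd x y => fun v => as_rep rho P M x v + as_rep rho P M y v
  | AMul x y => fun v => as_rep rho P M x (as_rep rho P M y v)
  end.

Lemma as_sigmaV_scalar c : sigmaV c%:A = c%:A.
Proof. by rewrite as_sigmaVZ -[1 in LHS](rmorph1 sigma) as_sigmaK. Qed.

Section Rep.
Variables (V : zmodType) (rho : R -> V -> V) (P M : V -> V).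
Hypothesis mod : ambiskew_module rho P M.

Local Notation rep := (as_rep rho P M).

Let rho0 v : rho 0 v = 0.
Proof. by case: mod => _ _ _ rD _ _ _ _ _; apply: (addrI (rho 0 v)); rewrite -rD // !addr0. Qed.

Lemma as_repD x : {morph rep x : v w / v + w}.
Proof.
case: mod => Dr DP DM _ _ _ _ _ _.
elim: x => [r||| x IHx y IHy | x IHx y IHy] v w /=; rewrite ?(Dr, DP, DM) //.
  by rewrite IHx IHy addrACA.
by rewrite IHy IHx.
Qed.

Lemma as_rep_scalar x c v : rep x (rho c%:A v) = rho c%:A (rep x v).
Proof.
case: mod => Dr DP DM DD MM _ sP sM _.
elim: x v => [r||| x IHx y IHy | x IHx y IHy] v //=.
- by rewrite -!MM -scalerAl mul1r -scalerAr mulr1.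
- by rewrite sP linearZ rmorph1.
- by rewrite sM as_sigmaV_scalar.
- by rewrite IHx IHy Dr.
- by rewrite IHy IHx.
Qed.

Lemma as_rep_rel x y : ambiskew_rel D x y -> rep x =1 rep y.
Proof.
case: (mod) => Dr DP DM DD MM r1 sP sM sPM.
elim=> {x y} //=.
- by move=> x y _ xy v; rewrite xy.
- by move=> x y z _ xy _ yz v; rewrite xy yz.
- by move=> x x' y y' _ xx' _ yy' v; rewrite xx' yy'.
- by move=> x x' y y' _ xx' _ yy' v; rewrite xx' yy'.
- by move=> x y z v; rewrite addrA.
- by move=> x y v; rewrite addrC.
- by move=> x v; rewrite rho0 add0r.
- by move=> x v; rewrite -{2}[rep x v]r1 -DD addNr rho0.
- by move=> x v; rewrite r1.
- by move=> x v; rewrite r1.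
- by move=> x y z v; rewrite as_repD.
- by move=> c x v; rewrite as_rep_scalar.
Qed.

Definition as_action (x : ambiskew D) : V -> V := rep (as_repr x).

Lemma as_action_of t : as_action (as_of D t) =1 rep t.
Proof. by apply: as_rep_rel; apply/as_ofP; rewrite as_reprK. Qed.

Lemma as_actionD x y v : as_action (x + y) v = as_action x v + as_action y v.
Proof.
elim/as_of_ind: x => x; elim/as_of_ind: y => y.
by rewrite -[_ + _]as_of_add !as_action_of.
Qed.

Lemma as_actionM x y v : as_action (x * y) v = as_action x (as_action y v).
Proof.
elim/as_of_ind: x => x; elim/as_of_ind: y => y.
by rewrite -[_ * _]as_of_mul !as_action_of.
Qed.

Lemma as_action_coef r : as_action (as_coef D r) =1 rho r.
Proof. exact: as_action_of. Qed.

Lemma as_action_Xp : as_action (as_Xp D) =1 P.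
Proof. exact: as_action_of. Qed.

Lemma as_action_Xm : as_action (as_Xm D) =1 M.
Proof. exact: as_action_of. Qed.

End Rep.

Lemma as_gen_ind (Q : ambiskew D -> Prop) :
    (forall r, Q (as_coef D r)) -> Q (as_Xp D) -> Q (as_Xm D) ->
    (forall x y, Q x -> Q y -> Q (x + y)) -> (forall x y, Q x -> Q y -> Q (x * y)) ->
  forall x, Q x.
Proof.
move=> Qr Qp Qm QD QM; elim/as_of_ind; elim=> //= x IHx y IHy.
  by rewrite as_of_add; apply: QD.
by rewrite as_of_mul; apply: QM.
Qed.

Record ambiskew_hom (B : pzRingType) (f : R -> B) (xp xm : B) : Prop := AmbiskewHom {
  ah_add : {morph f : r s / r + s};
  ah_mul : {morph f : r s / r * s};
  ah_one : f 1 = 1;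
  ah_p : forall r, xp * f r = f (sigma r) * xp;
  ah_m : forall r, xm * f r = f (sigmaV r) * xm;
  ah_pm : xp * xm = f h + f xi%:A * (xm * xp)
}.

(** B becomes a module through left multiplication by the images of the generators, and the image of
    x is its action on 1. *)
Definition as_lift (B : pzRingType) (f : R -> B) (xp xm : B) (x : ambiskew D) : B :=
  as_action (fun r b => f r * b) (fun b => xp * b) (fun b => xm * b) x 1.

Section Lift.
Variables (B : pzRingType) (f : R -> B) (xp xm : B).
Hypothesis hom : ambiskew_hom f xp xm.

Local Notation lift := (as_lift f xp xm).

Let mod : ambiskew_module (fun r b => f r * b) (fun b => xp * b) (fun b => xm * b).
Proof.
case: hom => fD fM f1 fp fm fpm; split=> [r v w|v w|v w|r s v|r s v|v|r v|r v|v];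
  rewrite ?mulrDr ?fD ?fM ?f1 ?mulrDl ?mul1r -?mulrA //.
- by rewrite mulrA fp mulrA.
- by rewrite mulrA fm mulrA.
- by rewrite mulrA fpm mulrDl !mulrA.
Qed.

Lemma as_lift_coef r : lift (as_coef D r) = f r.
Proof. by rewrite /as_lift as_action_coef // mulr1. Qed.

Lemma as_lift_Xp : lift (as_Xp D) = xp.
Proof. by rewrite /as_lift as_action_Xp // mulr1. Qed.

Lemma as_lift_Xm : lift (as_Xm D) = xm.
Proof. by rewrite /as_lift as_action_Xm // mulr1. Qed.

Lemma as_liftD : {morph lift : x y / x + y}.
Proof. by move=> x y; apply: as_actionD. Qed.

Lemma as_liftM : {morph lift : x y / x * y}.
Proof.
(* Every element, not only a generator, acts by left multiplication by its value on 1;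
   multiplicativity follows. *)
have E z b : as_action (fun r b => f r * b) (fun b => xp * b) (fun b => xm * b) z b =
    lift z * b.
  elim/as_gen_ind: z b => [r|||x y IHx IHy|x y IHx IHy] b.
  - by rewrite as_lift_coef as_action_coef.
  - by rewrite as_lift_Xp as_action_Xp.
  - by rewrite as_lift_Xm as_action_Xm.
  - by rewrite as_actionD // IHx IHy as_liftD mulrDl.
  - by rewrite /as_lift !as_actionM // !IHx !IHy mulr1 mulrA.
by move=> x y; rewrite {1}/as_lift as_actionM // E.
Qed.

Lemma as_lift1 : lift 1 = 1.
Proof. by rewrite -[RHS](ah_one hom); apply: as_lift_coef. Qed.

End Lift.

Lemma as_scaleE (c : k) (x : ambiskew D) : c *: x = as_coef D c%:A * x.
Proof. by []. Qed.

Lemma as_lift_lrmorphism (B : algType k) (f : {lrmorphism R -> B}) xp xm :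
    ambiskew_hom f xp xm ->
  exists phi : {lrmorphism ambiskew D -> B}, phi =1 as_lift f xp xm.
Proof.
move=> hom; pose g := as_lift f xp xm.
have g_lin : linear g.
  move=> c x y; rewrite [g _]as_liftD // as_scaleE [as_lift _ _ _ _]as_liftM //.
  by rewrite as_lift_coef // linearZ rmorph1 -scalerAl mul1r.
have g_mon : monoid_morphism g by split; [exact: as_lift1 | exact: as_liftM].
pose gL := GRing.isLinear.Build k _ _ _ g g_lin.
pose gM := GRing.isMonoidMorphism.Build _ _ g g_mon.
pose phi : {lrmorphism ambiskew D -> B} := HB.pack g gL gM.
by exists phi.
Qed.

End AmbiskewModules.

(** * Linear independence of 1, X_+, X_-, X_- X_+ over R *)

Section LowDegreeCoefficients.
Variables (k : fieldType) (R : algType k) (D : ambiskew_data R).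

Local Notation sigma := (as_sigma D).
Local Notation sigmaV := (as_sigmaV D).
Local Notation h := (as_h D).
Local Notation xi := (as_xi D).

Lemma as_sigmaVM1 : sigmaV 1 = 1.
Proof. by rewrite -[in LHS](rmorph1 sigma) as_sigmaK. Qed.

(* The left regular representation in the basis X_-^i X_+^j over R; the formula for
   X_+ comes from X_+ X_-^i = as_hseq i X_-^(i-1) + xi^i X_-^i X_+. *)
Let rho (r : R) (f : nat -> nat -> R) : nat -> nat -> R := fun i j => r * f i j.
Let P (f : nat -> nat -> R) : nat -> nat -> R := fun i j =>
  sigma (f i.+1 j) * as_hseq D i.+1 + (if j is j'.+1 then xi ^+ i *: sigma (f i j') else 0).
Let M (f : nat -> nat -> R) : nat -> nat -> R := fun i j =>
  if i is i'.+1 then sigmaV (f i' j) else 0.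

Let fext (f g : nat -> nat -> R) : (forall i j, f i j = g i j) -> f = g.
Proof. by move=> fg; apply: funext => i; apply: funext => j. Qed.

Let mod : ambiskew_module D rho P M.
Proof.
split=> [r v w|v w|v w|r s v|r s v|v|r v|r v|v]; apply: fext => i j;
  rewrite /rho /P /M ?addrfctE /=.
- by rewrite mulrDr.
- rewrite raddfD mulrDl /=; case: j => [|j]; first by rewrite !addr0.
  by rewrite raddfD scalerDr addrACA.
- by case: i => [|i]; rewrite ?addr0 // as_sigmaVD.
- by rewrite mulrDl.
- by rewrite mulrA.
- by rewrite mul1r.
- rewrite rmorphM [in RHS]mulrDr mulrA; case: j => [|j]; first by rewrite mulr0.
  by rewrite rmorphM scalerAr.
- by case: i => [|i]; rewrite ?mulr0 // as_sigmaVM.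
- rewrite as_sigmaVK mulrDr (as_h_central D) -!scalerAl mul1r -scalerAr -addrA.
  congr (_ + _); case: i => [|i] /=.
    rewrite as_sigmaV0 mulr0 scaler0 add0r.
    by case: j => [|j] //; rewrite raddf0 scaler0.
  rewrite [in RHS]as_sigmaVD as_sigmaVM as_sigmaK scalerDr; congr (_ + _).
  case: j => [|j]; first by rewrite as_sigmaV0 scaler0.
  by rewrite as_sigmaVZ as_sigmaK as_sigmaVK scalerA exprS.
Qed.

Let delta (i j : nat) : R := ((i == 0%N) && (j == 0%N))%:R.
Let coef (a : ambiskew D) := as_action rho P M a delta.

(** [delta] is the coordinate array of 1, so acting on it yields the coordinates of an element. They
    stand on the left of the monomials; multiplying them on the right by the prescribed values
    therefore keeps left R-linearity. *)
Lemma low_degree_coefs (v1 vp vm vmp : R) :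
  exists p : {linear ambiskew D -> R},
    [/\ forall r a, p (as_coef D r * a) = r * p a,
        [/\ p 1 = v1, p (as_Xp D) = vp & p (as_Xm D) = vm] &
        p (as_Xm D * as_Xp D) = vmp].
Proof.
pose p (a : ambiskew D) : R :=
  coef a 0%N 0%N * v1 + coef a 0%N 1%N * vp + coef a 1%N 0%N * vm + coef a 1%N 1%N * vmp.
have pM r a : p (as_coef D r * a) = r * p a.
  by rewrite /p /coef as_actionM // as_action_coef // /rho -!mulrA -!mulrDr.
have pD a b : p (a + b) = p a + p b.
  rewrite /p /coef as_actionD // !addrfctE !mulrDl.
  by rewrite (addrACA (_ * v1)) (addrACA (_ * v1 + _)) (addrACA (_ * v1 + _ + _)).
have p_lin : linear p.
  by move=> c a b; rewrite pD as_scaleE pM -scalerAl mul1r.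
pose pL := GRing.isLinear.Build k _ _ _ p p_lin.
pose q : {linear ambiskew D -> R} := HB.pack p pL.
have simp := (mulr0, mul0r, mul1r, addr0, add0r, scaler0, scale1r, expr0, raddf0 sigma,
  rmorph1 sigma, as_sigmaV0, as_sigmaVM1).
exists q; split=> //; [split|]; rewrite -[q _]/(p _) /p /coef.
- by rewrite -[1]/(as_coef D 1) as_action_coef // /rho /delta /= !simp.
- by rewrite as_action_Xp // /P /delta /= !simp.
- by rewrite as_action_Xm // /M /delta /= !simp.
by rewrite as_actionM // as_action_Xm // as_action_Xp // /M /P /delta /= !simp.
Qed.

End LowDegreeCoefficients.

(** * Part (i): the Hopf structure on A *)

Section HopfAmbiskew.
Variables (k : fieldType) (R : algType k) (H : hopf R).
Variables (chi : {lrmorphism R -> k^o}) (z h yp ym : R).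
Hypothesis hc : hopf_conditions H chi z h yp ym.

Local Notation Delta := (hopf_comul H).
Local Notation eps := (hopf_counit H).
Local Notation S := (hopf_antipode H).
Local Notation sg := (winding_l H chi).
Local Notation sgV := (winding_l H (char_inv H chi)).
Local Notation Yp := (S yp).
Local Notation Ym := (S ym).

Let xi : k := chi yp.

Let gyp : grouplike H yp. Proof. by case: (hc_yp hc). Qed.
Let gym : grouplike H ym. Proof. by case: (hc_ym hc). Qed.

Let xi_neq0 : xi != 0. Proof. exact: char_grouplike_neq0 gyp. Qed.

Definition hopf_ambiskew_data : ambiskew_data R :=
  AmbiskewData (as_sigma := sg)
    (winding_lK (char_invr H chi) : cancel sg sgV) (winding_lK (char_invl H chi))
    (hc_h_central hc) xi_neq0.

Local Notation D := hopf_ambiskew_data.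
Local Notation A := (ambiskew D).
Local Notation i := (as_coef D).
Local Notation Xp := (as_Xp D).
Local Notation Xm := (as_Xm D).

Let ypK : yp * Yp = 1. Proof. by case: (grouplike_inv gyp). Qed.
Let ypVK : Yp * yp = 1. Proof. by case: (grouplike_inv gyp). Qed.
Let ymK : ym * Ym = 1. Proof. by case: (grouplike_inv gym). Qed.
Let ymVK : Ym * ym = 1. Proof. by case: (grouplike_inv gym). Qed.
Let ypm : yp * ym = ym * yp. Proof. by rewrite -(hc_z_pm hc) (hc_z_mp hc). Qed.
Let zC : central (yp * ym). Proof. rewrite -(hc_z_pm hc); exact: (hc_z_central hc). Qed.
Let YpmC : Yp * Ym = Ym * Yp. Proof. by rewrite -!antipodeM ypm. Qed.

Let sgK : cancel sg sgV. Proof. exact: winding_lK (char_invr H chi). Qed.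
Let sgVK : cancel sgV sg. Proof. exact: winding_lK (char_invl H chi). Qed.

Let inv_eq (x y y' : R) : x * y = 1 -> y' * x = 1 -> y = y'.
Proof. by move=> xy y'x; rewrite -[y]mul1r -y'x -mulrA xy mulr1. Qed.

Let sg_yp : sg yp = xi *: yp. Proof. exact: winding_l_grouplike. Qed.
Let sg_ym : sg ym = xi *: ym.
Proof. by rewrite /xi (hc_chi hc); apply: winding_l_grouplike. Qed.
Let sg_inv (f : {lrmorphism R -> R}) (c : k) (y y' : R) :
  c != 0 -> y * y' = 1 -> y' * y = 1 -> f y = c *: y -> f y' = c^-1 *: y'.
Proof.
move=> c0 yy' y'y fy; apply: (inv_eq (x := f y)); first by rewrite -rmorphM yy' rmorph1.
by rewrite fy -scalerAl -scalerAr y'y scalerA mulVf // scale1r.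
Qed.
Let sg_Yp : sg Yp = xi^-1 *: Yp. Proof. exact: (sg_inv xi_neq0 ypK ypVK sg_yp). Qed.
Let sg_Ym : sg Ym = xi^-1 *: Ym. Proof. exact: (sg_inv xi_neq0 ymK ymVK sg_ym). Qed.
Let sgV_of c y : c != 0 -> sg y = c *: y -> sgV y = c^-1 *: y.
Proof.
move=> c0 sy; apply: (can_inj sgK).
by rewrite linearZ /= sgVK sy scalerA mulVf // scale1r.
Qed.
Let sgV_yp : sgV yp = xi^-1 *: yp. Proof. exact: sgV_of. Qed.
Let sgV_ym : sgV ym = xi^-1 *: ym. Proof. exact: sgV_of. Qed.
Let sgV_Yp : sgV Yp = xi *: Yp.
Proof. by rewrite -[xi]invrK; apply: sgV_of; rewrite ?invr_eq0. Qed.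
Let sg_ad a : sg a = yp * winding_r H chi a * Yp.
Proof. by rewrite (hc_winding hc) /= ad_l_grouplike. Qed.

(** Delta sigma = (sigma ⊗ 1) Delta; writing this sigma as ad(y_+) tau^r leaves tau^r in the first
    factor, and [tmap_winding] carries it to tau^l = sigma in the second. *)
Let sg_comul a : Delta (sg a) * (yp ⊗ 1) = (yp ⊗ 1) * tmap idfun sg (Delta a).
Proof.
rewrite -tmap_winding comul_winding_l; elim/tensor_ind: (Delta a) => [u v||u v IH IH'].
- by rewrite !tmap_tens !tens_mul mulr1 mul1r /= sg_ad -!mulrA ypVK mulr1.
- by rewrite !linear0 mulr0 mul0r.
- by rewrite !linearD mulrDr mulrDl IH IH'.
Qed.

(** Applying 1 ⊗ sigma^-1 to [sg_comul] at sigma^-1(a) gives the identity with y_+^-1 in place of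
    y_-; the two conjugate alike since y_+ y_- is central. *)
Let sgV_comul a : Delta (sgV a) * (ym ⊗ 1) = (ym ⊗ 1) * tmap idfun sgV (Delta a).
Proof.
have E := congr1 (tmap idfun sgV) (sg_comul (sgV a)).
rewrite sgVK !tmap_mul !tmap_tens rmorph1 tmap_comp /= in E.
rewrite [X in (yp ⊗ 1) * X](_ : _ = Delta (sgV a)) in E; last first.
  by rewrite -[RHS]tmap_id; apply: eq_tmap => // x; apply: sgK.
have zT t : ((yp * ym) ⊗ 1 : (R ⊗ R)%type) * t = t * ((yp * ym) ⊗ 1).
  elim/tensor_ind: t => [u v||u v IH IH'].
  - by rewrite !tens_mul mul1r mulr1 zC.
  - by rewrite mulr0 mul0r.
  - by rewrite mulrDr mulrDl IH IH'.
have YpU : (yp ⊗ 1) * (Yp ⊗ 1) = 1 :> (R ⊗ R)%type by rewrite tens_mul ypK mulr1.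
rewrite -[RHS]mulr1 -YpU.
rewrite -mulrA [X in _ = _ * X]mulrA E !mulrA tens_mul mulr1 -ypm zT -!mulrA tens_mul mulr1.
by rewrite ypm -mulrA ypK mulr1.
Qed.

Let ii_scalar c (b : (A ⊗ A)%type) : tmap i i (Delta c%:A) * b = c *: b.
Proof. by rewrite linearZ /= linearZ /= comul1 tmap_tens !rmorph1 -tens_scaleAl mul1r. Qed.

Lemma hopf_ambiskew_comul_hom :
  ambiskew_hom D (fun r => tmap i i (Delta r)) (Xp ⊗ 1 + i yp ⊗ Xp) (Xm ⊗ 1 + i ym ⊗ Xm).
Proof.
have Xpi := as_Xp_coef D; have Xmi := as_Xm_coef D.
split=> [r s|r s||r|r|].
- by rewrite !linearD.
- by rewrite comulM tmap_mul.
- by rewrite comul1 tmap_tens !rmorph1.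
- rewrite [in RHS]mulrDr [in RHS]coef_tensr mulrDl.
  rewrite (skew_tensl (s := sg)) // (skew_tensr (s := sg)) //.
  by rewrite -sg_comul -comul_winding_l.
- rewrite [in RHS]mulrDr [in RHS]coef_tensr mulrDl.
  rewrite (skew_tensl (s := sgV)) // (skew_tensr (s := sgV)) //.
  by rewrite -sgV_comul -comul_winding_l.
(* The terms in X_+ ⊗ X_- and X_- ⊗ X_+ agree on the two sides because [sigma] multiplies both y_+
   and y_- by the xi of the relation. What remains is h ⊗ 1 + z ⊗ h, the coproduct of h. *)
rewrite ii_scalar (hc_h_skew hc) linearD /= !tmap_tens rmorph1.
rewrite !mulrDr !mulrDl !tens_mul !mulr1 !mul1r as_XpXm Xpi Xmi.
rewrite -[as_sigma D ym]/(sg ym) -[as_sigmaV D yp]/(sgV yp) sg_ym sgV_yp.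
rewrite !linearZ /= -!scalerAl -!rmorphM -ypm -(hc_z_pm hc) !(tensDl, tensDr) !(tensZl, tensZr).
rewrite !scalerDr scalerA divff // scale1r.
by rewrite [LHS](AC (3*(1*2)) ((1*5)*((2*4)*(3*6)))).
Qed.

(* Every anti-endomorphism below sends X± to a multiple of y±^-1 X±; the antipode is the
   case c = 1, and its inverse the case c = xi^-1. *)
Definition as_anti (g : R -> R) (c : k) : A -> A :=
  @as_lift _ _ D A^c (fun r => i (g r)) (- (c *: (i Yp * Xp))) (- (c^-1 *: (i Ym * Xm))).

Section AntiEndomorphism.
Variables (g : {linear R -> R}) (c : k).
Hypotheses (c_neq0 : c != 0) (gM : forall a b, g (a * b) = g b * g a) (g1 : g 1 = 1).
Hypothesis gh : g h = - (Yp * Ym * h).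
Hypothesis sgg : forall r, sg (g (sg r)) = yp * g r * Yp.

Local Notation T := (as_anti g c).

Let sgVg r : sgV (g (sgV r)) = ym * g r * Ym.
Proof.
have := congr1 sgV (sgg (sgV r)); rewrite sgK sgVK !rmorphM /= sgV_yp sgV_Yp => ->.
rewrite -!scalerAl -!scalerAr scalerA mulVf // scale1r !mulrA -ypm zC -!mulrA YpmC.
by rewrite (mulrA ym) ymK mul1r ypK mulr1.
Qed.

Lemma as_anti_hom :
  ambiskew_hom D (B := A^c) (fun r => i (g r))
    (- (c *: (i Yp * Xp))) (- (c^-1 *: (i Ym * Xm))).
Proof.
split=> [r s|r s||r|r|].
- by rewrite !linearD.
- by rewrite gM rmorphM.
- by rewrite g1 rmorph1.
- change (i (g r) * - (c *: (i Yp * Xp)) = - (c *: (i Yp * Xp)) * i (g (sg r))).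
  rewrite mulrN mulNr -scalerAl -scalerAr -!mulrA as_Xp_coef -[as_sigma D _]/(sg _) sgg.
  by rewrite !mulrA -!rmorphM !mulrA ypVK mul1r.
- change (i (g r) * - (c^-1 *: (i Ym * Xm)) = - (c^-1 *: (i Ym * Xm)) * i (g (sgV r))).
  rewrite mulrN mulNr -scalerAl -scalerAr -!mulrA as_Xm_coef -[as_sigmaV D _]/(sgV _) sgVg.
  by rewrite !mulrA -!rmorphM !mulrA ymVK mul1r.
(* The scalars c and c^-1 cancel, and moving y_+^-1 past X_- and y_-^-1 past X_+ produces xi and
   xi^-1. Both sides become xi z^-1 X_- X_+, as g(h) = - z^-1 h removes the h of X_+ X_-. *)
change (- (c^-1 *: (i Ym * Xm)) * - (c *: (i Yp * Xp)) =
  i (g h) + (- (c *: (i Yp * Xp)) * - (c^-1 *: (i Ym * Xm))) * i (g xi%:A)).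
have cc (a b : A) (d e : k) : d * e = 1 -> - (d *: a) * - (e *: b) = a * b.
  by move=> de; rewrite mulrNN -scalerAl -scalerAr scalerA de scale1r.
rewrite !cc ?mulVf ?divff // !linearZ /= g1 rmorph1 -scalerAr mulr1 gh.
have -> : i Ym * Xm * (i Yp * Xp) = xi *: (i (Yp * Ym) * (Xm * Xp)).
  rewrite mulrA -[_ * Xm * _]mulrA as_Xm_coef -[as_sigmaV D _]/(sgV _) sgV_Yp.
  by rewrite linearZ /= -scalerAl -scalerAr -scalerAl YpmC rmorphM !mulrA.
have -> : i Yp * Xp * (i Ym * Xm) = xi^-1 *: (i (Yp * Ym) * (Xp * Xm)).
  rewrite mulrA -[_ * Xp * _]mulrA as_Xp_coef -[as_sigma D _]/(sg _) sg_Ym.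
  by rewrite linearZ /= -scalerAl -scalerAr -scalerAl rmorphM !mulrA.
rewrite scalerA divff // scale1r as_XpXm mulrDr -rmorphM rmorphN /= addrA addNr add0r.
by rewrite scalerAr.
Qed.

Lemma as_anti_coef r : T (i r) = i (g r).
Proof. exact: (as_lift_coef as_anti_hom). Qed.

Lemma as_anti_Xp : T Xp = - (c *: (i Yp * Xp)).
Proof. exact: (as_lift_Xp as_anti_hom). Qed.

Lemma as_anti_Xm : T Xm = - (c^-1 *: (i Ym * Xm)).
Proof. exact: (as_lift_Xm as_anti_hom). Qed.

Lemma as_antiD : {morph T : x y / x + y}.
Proof. exact: (as_liftD as_anti_hom). Qed.

Lemma as_antiM x y : T (x * y) = T y * T x.
Proof. exact: (as_liftM as_anti_hom). Qed.

Lemma as_anti_linear : linear T.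
Proof.
move=> a x y; rewrite as_antiD as_scaleE as_antiM as_anti_coef.
by rewrite !linearZ /= g1 rmorph1 -scalerAr mulr1.
Qed.

End AntiEndomorphism.

Let Sinv : exists2 S' : {linear R -> R}, cancel S S' & cancel S' S.
Proof.
have [S' SK S'K] := hopf_antipode_bij H.
have Sl : linear S' by move=> c x y; apply: (can_inj SK); rewrite linearP !S'K.
by exists (of_linear Sl).
Qed.

(** S turns the inner tau^l of [chi] into tau^r of the inverse character, which cancels the tau^r of
    [chi] inside the outer sigma = ad(y_+) tau^r. *)
Let sgS r : sg (S (sg r)) = yp * S r * Yp.
Proof. by rewrite antipode_winding_l sg_ad (winding_rK (char_invr H chi)). Qed.

Let counit_h : eps h = 0.
Proof.
have := hopf_counitl H h; rewrite (hc_h_skew hc) tliftD ?tlift_tens;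
  try exact: winding_l_bilinear.
have [_ ->] := hc_z_grouplike hc.
rewrite scale1r => /(canRL (addrK _)) /eqP; rewrite subrr scaler_eq0 oner_eq0 orbF.
by move/eqP.
Qed.

Let antipode_h : S h = - (Yp * Ym * h).
Proof.
have := hopf_antipodel H h; rewrite (hc_h_skew hc) tliftD ?tlift_tens;
  try exact: mul_antil_bilinear.
rewrite counit_h scale0r mulr1 (hc_z_pm hc) antipodeM YpmC => /(canRL (addrK _)).
by rewrite add0r.
Qed.

Let S_Yp : S Yp = yp.
Proof. by apply: (inv_eq (x := Yp)) ypK; rewrite -antipodeM ypVK antipode1. Qed.
Let S_Ym : S Ym = ym.
Proof. by apply: (inv_eq (x := Ym)) ymK; rewrite -antipodeM ymVK antipode1. Qed.

(** The composite sends X_+ to c c' y_+^-1 X_+ y_+ = c c' xi X_+ and multiplies X_- by the inverse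
    scalar, whence the condition c c' = xi^-1. *)
Lemma as_antiK (g g' : {linear R -> R}) (c c' : k) :
    c != 0 -> c' != 0 -> c * c' = xi^-1 ->
    (forall a b, g (a * b) = g b * g a) -> (forall a b, g' (a * b) = g' b * g' a) ->
    g 1 = 1 -> g' 1 = 1 -> g h = - (Yp * Ym * h) -> g' h = - (Yp * Ym * h) ->
    (forall r, sg (g (sg r)) = yp * g r * Yp) ->
    (forall r, sg (g' (sg r)) = yp * g' r * Yp) ->
    cancel g g' -> g' Yp = yp -> g' Ym = ym ->
  cancel (as_anti g c) (as_anti g' c').
Proof.
move=> c0 c'0 cc' gM g'M g1 g'1 gh g'h sgg sgg' gK g'Y g'Z.
have TM := as_antiM c0 gM g1 gh sgg; have T'M := as_antiM c'0 g'M g'1 g'h sgg'.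
have T'L := as_anti_linear c'0 g'M g'1 g'h sgg'.
have T'N x : as_anti g' c' (- x) = - as_anti g' c' x by exact: (linearN (of_linear T'L)).
have T'Z d x : as_anti g' c' (d *: x) = d *: as_anti g' c' x.
  exact: (linearZ_LR (of_linear T'L)).
elim/as_gen_ind => [r|||x y IHx IHy|x y IHx IHy].
- by rewrite !as_anti_coef // gK.
- rewrite as_anti_Xp // T'N T'Z T'M as_anti_Xp // as_anti_coef // g'Y.
  rewrite mulNr scalerN opprK -scalerAl -mulrA as_Xp_coef -[as_sigma D _]/(sg _) sg_yp.
  rewrite [i (_ *: _)]linearZ /= -scalerAl -scalerAr mulrA -rmorphM ypVK rmorph1 mul1r !scalerA cc'.
  by rewrite mulVf // scale1r.
- rewrite as_anti_Xm // T'N T'Z T'M as_anti_Xm // as_anti_coef // g'Z.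
  rewrite mulNr scalerN opprK -scalerAl -mulrA as_Xm_coef -[as_sigmaV D _]/(sgV _) sgV_ym.
  rewrite [i (_ *: _)]linearZ /= -scalerAl -scalerAr mulrA -rmorphM ymVK rmorph1 mul1r !scalerA.
  by rewrite -invfM cc' invrK divff // scale1r.
- by rewrite (as_antiD c0) // (as_antiD c'0) // IHx IHy.
- by rewrite TM T'M IHx IHy.
Qed.

Lemma hopf_ambiskew_antipode_bij : bijective (as_anti S 1).
Proof.
have [S' SK S'K] := Sinv.
have S'M a b : S' (a * b) = S' b * S' a.
  by apply: (can_inj SK); rewrite antipodeM !S'K.
have S'1 : S' 1 = 1 by rewrite -[in LHS](antipode1 H) SK.
have S'h : S' h = - (Yp * Ym * h).
  apply: (can_inj SK); rewrite S'K raddfN /= !antipodeM antipode_h S_Yp S_Ym.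
  rewrite mulNr opprK -(mulrA _ h) (hc_h_central hc) YpmC -ypm -!mulrA.
  by rewrite (mulrA Yp) ypVK mul1r mulrA ymVK mul1r.
(* This is [sgS] at sigma^-1(S' r), after [sgV] and S have been applied to both sides; the two
   scalars from y_+ and y_+^-1 cancel. *)
have S'sg r : sg (S' (sg r)) = yp * S' r * Yp.
  apply: (can_inj sgVK); rewrite sgK !rmorphM /= sgV_yp sgV_Yp.
  rewrite -!scalerAl -!scalerAr scalerA mulVf // scale1r.
  apply: (can_inj SK); rewrite S'K !antipodeM S_Yp mulrA.
  by have := sgS (sgV (S' r)); rewrite sgVK S'K.
have xiV : xi^-1 != 0 by rewrite invr_eq0.
exists (as_anti S' xi^-1); apply: as_antiK; rewrite ?oner_neq0 ?mul1r ?mulr1 ?SK ?S_Yp ?S_Ym //;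
  try exact: antipodeM; try exact: antipode1.
Qed.

Local Notation comulA := (as_lift (fun r => tmap i i (Delta r)) (Xp ⊗ 1 + i yp ⊗ Xp)
  (Xm ⊗ 1 + i ym ⊗ Xm)).

Lemma hopf_ambiskew_counit_hom : ambiskew_hom D (eps : R -> k^o) 0 0.
Proof.
split=> [r s|r s||r|r|]; rewrite ?mulr0 ?mul0r //.
- exact: linearD.
- exact: rmorphM.
- exact: rmorph1.
- by rewrite addr0; apply: esym counit_h.
Qed.

(** Each axiom holds on a set closed under sums and products, so it is checked on R, where it is the
    axiom of [H], and on X_+ and X_-, where it uses that y_+ and y_- are grouplike. *)
Lemma hopf_ambiskew_hopf : exists HA : hopf A,
  [/\ hopf_extends H HA i, hopf_comul HA Xp = Xp ⊗ 1 + i yp ⊗ Xp,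
      hopf_comul HA Xm = Xm ⊗ 1 + i ym ⊗ Xm,
      hopf_antipode HA Xp = - i Yp * Xp & hopf_antipode HA Xm = - i Ym * Xm].
Proof.
have homD := hopf_ambiskew_comul_hom.
have comulA_linear : linear (comulA : A -> (A ⊗ A)%type).
  move=> a x y; rewrite as_liftD // as_scaleE as_liftM // as_lift_coef //.
  by rewrite ii_scalar.
pose dl : {linear A -> (A ⊗ A)%type} := of_linear comulA_linear.
have dl_coef r : dl (i r) = tmap i i (Delta r) by exact: as_lift_coef.
have dl_Xp : dl Xp = Xp ⊗ 1 + i yp ⊗ Xp by exact: as_lift_Xp.
have dl_Xm : dl Xm = Xm ⊗ 1 + i ym ⊗ Xm by exact: as_lift_Xm.
have dlM : {morph dl : x y / x * y} by exact: as_liftM.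
have dl1 : dl 1 = 1 ⊗ 1 by exact: as_lift1.
have [eA eAE] := as_lift_lrmorphism hopf_ambiskew_counit_hom.
have eA_coef r : eA (i r) = eps r.
  by rewrite eAE (as_lift_coef hopf_ambiskew_counit_hom).
have eA_Xp : eA Xp = 0 by rewrite eAE (as_lift_Xp hopf_ambiskew_counit_hom).
have eA_Xm : eA Xm = 0 by rewrite eAE (as_lift_Xm hopf_ambiskew_counit_hom).
pose SA : {linear A -> A} := of_linear
  (as_anti_linear (oner_neq0 k) (antipodeM H) (antipode1 H) antipode_h sgS).
have SAM x y : SA (x * y) = SA y * SA x.
  exact: (as_antiM (oner_neq0 k) (antipodeM H) (antipode1 H) antipode_h sgS).
have SA_coef r : SA (i r) = i (S r).
  exact: (as_anti_coef (oner_neq0 k) (antipodeM H) (antipode1 H) antipode_h sgS).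
have SA_Xp : SA Xp = - (i Yp * Xp).
  rewrite -[i Yp * Xp]scale1r.
  exact: (as_anti_Xp (oner_neq0 k) (antipodeM H) (antipode1 H) antipode_h sgS).
have SA_Xm : SA Xm = - (i Ym * Xm).
  rewrite -[i Ym * Xm]scale1r -[1 in RHS]invr1.
  exact: (as_anti_Xm (oner_neq0 k) (antipodeM H) (antipode1 H) antipode_h sgS).
have SA1 : SA 1 = 1 by rewrite -(rmorph1 i) SA_coef antipode1.
have [Dyp eyp] := gyp; have [Dym eym] := gym.
have coassocX X y : Delta y = y ⊗ y -> dl X = X ⊗ 1 + i y ⊗ X ->
    tassoc (tmap dl idfun (dl X)) = tmap idfun dl (dl X).
  move=> Dy dX; rewrite dX !linearD /= !tmap_tens /= dX dl1 dl_coef Dy tmap_tens.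
  by rewrite tensDl tensDr linearD /= !tassoc_tens addrA.
have coassoc a : tassoc (tmap dl idfun (dl a)) = tmap idfun dl (dl a).
  elim/as_gen_ind: a => [r|||x y IHx IHy|x y IHx IHy].
  - rewrite dl_coef !tmap_comp.
    transitivity (tassoc (tmap (tmap i i) i (tmap Delta idfun (Delta r)))).
      by congr tassoc; rewrite tmap_comp; apply: eq_tmap => // u; apply: dl_coef.
    rewrite tassoc_tmap hopf_coassoc tmap_comp; apply: eq_tmap => // u.
    by rewrite /= dl_coef.
  - exact: coassocX Dyp dl_Xp.
  - exact: coassocX Dym dl_Xm.
  - by rewrite !linearD /= IHx IHy.
  - exact: coassoc_mul.
have counitl a : tlift (fun a1 a2 => eA a1 *: a2) (dl a) = a.
  have cX X y : eps y = 1 -> eA X = 0 -> dl X = X ⊗ 1 + i y ⊗ X ->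
      tlift (fun a1 a2 => eA a1 *: a2) (dl X) = X.
    move=> ey eX ->; rewrite tliftD ?tlift_tens; try exact: winding_l_bilinear.
    by rewrite eX scale0r add0r eA_coef ey scale1r.
  elim/as_gen_ind: a => [r|||x y IHx IHy|x y IHx IHy].
  - rewrite dl_coef tlift_tmap; last exact: winding_l_bilinear.
    rewrite -[in RHS](hopf_counitl H r) [in RHS]linear_tlift; apply: eq_tlift => u v.
    by rewrite linearZ /= eA_coef.
  - exact: cX eyp eA_Xp dl_Xp.
  - exact: cX eym eA_Xm dl_Xm.
  - by rewrite linearD tliftD ?IHx ?IHy //; apply: winding_l_bilinear.
  - rewrite dlM tlift_mul ?IHx ?IHy //; first exact: winding_l_bilinear.
    by move=> a1 a2 b1 b2; rewrite rmorphM -scalerAl -scalerAr scalerA.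
have counitr a : tlift (fun a1 a2 => eA a2 *: a1) (dl a) = a.
  have cX X y : eA X = 0 -> dl X = X ⊗ 1 + i y ⊗ X ->
      tlift (fun a1 a2 => eA a2 *: a1) (dl X) = X.
    move=> eX ->; rewrite tliftD ?tlift_tens; try exact: winding_r_bilinear.
    by rewrite eX scale0r addr0 rmorph1 scale1r.
  elim/as_gen_ind: a => [r|||x y IHx IHy|x y IHx IHy].
  - rewrite dl_coef tlift_tmap; last exact: winding_r_bilinear.
    rewrite -[in RHS](hopf_counitr H r) [in RHS]linear_tlift; apply: eq_tlift => u v.
    by rewrite linearZ /= eA_coef.
  - exact: cX eA_Xp dl_Xp.
  - exact: cX eA_Xm dl_Xm.
  - by rewrite linearD tliftD ?IHx ?IHy //; apply: winding_r_bilinear.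
  - rewrite dlM tlift_mul ?IHx ?IHy //; first exact: winding_r_bilinear.
    by move=> a1 a2 b1 b2; rewrite rmorphM -scalerAl -scalerAr scalerA.
have antipodel a : tlift (fun a1 a2 => SA a1 * a2) (dl a) = (eA a : k) *: (1 : A).
  have cX X y : inverse_of y (S y) -> SA X = - (i (S y) * X) -> eA X = 0 ->
      dl X = X ⊗ 1 + i y ⊗ X -> tlift (fun a1 a2 => SA a1 * a2) (dl X) = (eA X : k) *: (1 : A).
    move=> _ SX eX ->; rewrite tliftD ?tlift_tens; try exact: mul_antil_bilinear.
    by rewrite SX mulr1 SA_coef addNr eX scale0r.
  elim/as_gen_ind: a => [r|||x y IHx IHy|x y IHx IHy].
  - rewrite dl_coef tlift_tmap; last exact: mul_antil_bilinear.
    rewrite eA_coef -(rmorph1 i) -[RHS]linearZ -hopf_antipodel [in RHS]linear_tlift.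
    by apply: eq_tlift => u v; rewrite rmorphM SA_coef.
  - exact: cX (grouplike_inv gyp) SA_Xp eA_Xp dl_Xp.
  - exact: cX (grouplike_inv gym) SA_Xm eA_Xm dl_Xm.
  - by rewrite !linearD tliftD ?IHx ?IHy ?scalerDl //; apply: mul_antil_bilinear.
  - by rewrite dlM (mul_antil_mul SAM IHx IHy) rmorphM.
have antipoder a : tlift (fun a1 a2 => a1 * SA a2) (dl a) = (eA a : k) *: (1 : A).
  have cX X y : inverse_of y (S y) -> SA X = - (i (S y) * X) -> eA X = 0 ->
      dl X = X ⊗ 1 + i y ⊗ X -> tlift (fun a1 a2 => a1 * SA a2) (dl X) = (eA X : k) *: (1 : A).
    move=> [yS _] SX eX ->; rewrite tliftD ?tlift_tens; try exact: mul_antir_bilinear.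
    by rewrite SX SA1 mulr1 mulrN mulrA -rmorphM yS rmorph1 mul1r subrr eX scale0r.
  elim/as_gen_ind: a => [r|||x y IHx IHy|x y IHx IHy].
  - rewrite dl_coef tlift_tmap; last exact: mul_antir_bilinear.
    rewrite eA_coef -(rmorph1 i) -[RHS]linearZ -hopf_antipoder [in RHS]linear_tlift.
    by apply: eq_tlift => u v; rewrite rmorphM SA_coef.
  - exact: cX (grouplike_inv gyp) SA_Xp eA_Xp dl_Xp.
  - exact: cX (grouplike_inv gym) SA_Xm eA_Xm dl_Xm.
  - by rewrite !linearD tliftD ?IHx ?IHy ?scalerDl //; apply: mul_antir_bilinear.
  - by rewrite dlM (mul_antir_mul SAM IHx IHy) rmorphM.
have dl_mon : monoid_morphism dl by split.
exists (@Hopf _ _ dl eA SA dl_mon coassoc counitl counitr antipodel antipoder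
  hopf_ambiskew_antipode_bij).
by split=> //=; rewrite mulNr.
Qed.

End HopfAmbiskew.

(** * Part (ii): comparing coefficients in A ⊗ A *)

Section ExtendedComultiplication.
Variables (k : fieldType) (R A : algType k) (H : hopf R) (HA : hopf A).
Variable i : {lrmorphism R -> A}.
Hypothesis ext : hopf_extends H HA i.

Local Notation Delta := (hopf_comul H).
Local Notation eps := (hopf_counit H).
Local Notation S := (hopf_antipode H).
Local Notation DeltaA := (hopf_comul HA).
Local Notation epsA := (hopf_counit HA).

Definition left_linear (p : A -> R) := forall r a, p (i r * a) = r * p a.

Let ext_comul r : DeltaA (i r) = tmap i i (Delta r). Proof. by case: ext. Qed.
Let ext_counit r : epsA (i r) = eps r. Proof. by case: ext. Qed.

Lemma left_linear_coef p r : left_linear p -> p (i r) = r * p 1.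
Proof. by move=> pl; rewrite -pl mulr1. Qed.

(** Left linear functionals extract the coefficients in R ⊗ R of an element of A ⊗ A; every
    comparison below goes through this formula. *)
Lemma tmap_left_linear (p q : {linear A -> R}) t a b :
  left_linear p -> left_linear q ->
  tmap p q (tmap i i t * (a ⊗ b)) = t * (p a ⊗ q b).
Proof.
move=> pl ql; elim/tensor_ind: t => [u v||u v IH IH'].
- by rewrite !(tmap_tens, tens_mul) pl ql.
- by rewrite !(linear0, mul0r).
- by rewrite !(linearD, mulrDl) /= IH IH'.
Qed.

Section Grouplike.
Variables (X : A) (l r : R) (p0 p1 : {linear A -> R}).
Hypotheses (p0l : left_linear p0) (p1l : left_linear p1).
Hypotheses (p01 : p0 1 = 1) (p0X : p0 X = 0) (p11 : p1 1 = 0) (p1X : p1 X = 1).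
Hypothesis DX : DeltaA X = X ⊗ i r + i l ⊗ X.

Let p0i s : p0 (i s) = s. Proof. by rewrite left_linear_coef // p01 mulr1. Qed.
Let p1i s : p1 (i s) = 0. Proof. by rewrite left_linear_coef // p11 mulr0. Qed.

Let p0K t : tmap p0 p0 (tmap i i t) = t.
Proof.
by rewrite -[tmap i i t]mulr1 [1]tens_one tmap_left_linear // p01 -tens_one mulr1.
Qed.

Let coassocX : tassoc (tmap DeltaA idfun (DeltaA X)) =
  X ⊗ (i r ⊗ i r) + i l ⊗ (X ⊗ i r) + tassoc (tmap i i (Delta l) ⊗ X).
Proof. by rewrite DX !linearD /= !tmap_tens /= DX ext_comul tensDl linearD /= !tassoc_tens. Qed.

Let coassocX' : tassoc (tmap DeltaA idfun (DeltaA X)) =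
  X ⊗ tmap i i (Delta r) + i l ⊗ (X ⊗ i r + i l ⊗ X).
Proof. by rewrite hopf_coassoc DX !linearD /= !tmap_tens /= DX ext_comul. Qed.

(** In coassociativity at X, the terms with X in the first factor are X ⊗ r ⊗ r and X ⊗ Delta r;
    those with X in the last factor, Delta l ⊗ X and l ⊗ l ⊗ X, serve the next lemma. The counit
    axiom gives the value 1 of eps. *)
Lemma skew_comul_grouplike_right : grouplike H r.
Proof.
split; last first.
  have := hopf_counitr HA X; rewrite DX tliftD ?tlift_tens; try exact: winding_r_bilinear.
  move/(congr1 p1); rewrite linearD !linearZ /= p1X p1i scaler0 addr0 ext_counit.
  move/(congr1 eps); rewrite linearZ !rmorph1 => e; rewrite -[LHS]mulr1; exact: e.
have := congr1 (tmap p1 (tmap p0 p0)) coassocX'; rewrite coassocX !linearD /= !tmap_tens /=.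
rewrite -tassoc_tmap !tmap_tens p0X p1X p1i !p0K !p0i /= tens0r !tens0l linear0 !addr0.
have bil : bilinear_map (fun (a : R) (u : (R ⊗ R)%type) => (eps a : k) *: u).
  split=> [u|a] c x y; first by rewrite charP scalerDl scalerA.
  by rewrite scalerDr !scalerA mulrC.
move/(congr1 (tlift (fun (a : R) (u : (R ⊗ R)%type) => (eps a : k) *: u))).
by rewrite !(tlift_tens bil) rmorph1 !scale1r => <-.
Qed.

Lemma skew_comul_grouplike_left : grouplike H l.
Proof.
split; last first.
  have := hopf_counitl HA X; rewrite DX tliftD ?tlift_tens; try exact: winding_l_bilinear.
  move/(congr1 p1); rewrite linearD !linearZ /= p1X p1i scaler0 add0r ext_counit.
  move/(congr1 eps); rewrite linearZ !rmorph1 => e; rewrite -[LHS]mulr1; exact: e.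
have := congr1 (tmap p0 (tmap p0 p1)) coassocX'; rewrite coassocX !linearD /= !tmap_tens /=.
rewrite -tassoc_tmap linearD !tmap_tens /= !tmap_tens p0X p1X !p1i !p0K !p0i.
rewrite !(tens0l, tens0r) !add0r.
pose G : {linear (R ⊗ R)%type -> R} := of_linear (tlift_linear (winding_r_bilinear eps)).
move/(congr1 (tmap idfun G)).
have GE t : tmap idfun G (tassoc (t ⊗ 1)) = t.
  elim/tensor_ind: t => [u v||u v IH IH'].
  - rewrite tassoc_tens tmap_tens /= /G [of_linear _ _](tlift_tens (winding_r_bilinear eps)).
    by rewrite rmorph1 scale1r.
  - by rewrite tens0l !linear0.
  - by rewrite tensDl !linearD /= IH IH'.
by rewrite GE tmap_tens /= [of_linear _ _](tlift_tens (winding_r_bilinear eps)) rmorph1 scale1r.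
Qed.

End Grouplike.

Section SkewVariable.
Variables (X : A) (y : R) (s : {lrmorphism R -> R}) (p0 p1 : {linear A -> R}).
Hypotheses (p0l : left_linear p0) (p1l : left_linear p1).
Hypotheses (p01 : p0 1 = 1) (p0X : p0 X = 0) (p11 : p1 1 = 0) (p1X : p1 X = 1).
Hypothesis Xi : forall r, X * i r = i (s r) * X.
Hypothesis DX : DeltaA X = X ⊗ 1 + i y ⊗ X.

Let comulXi r :
  tmap i i (tmap s idfun (Delta r)) * (X ⊗ 1) +
    tmap i i ((y ⊗ 1) * tmap idfun s (Delta r)) * (1 ⊗ X) =
  tmap i i (Delta (s r)) * (X ⊗ 1) + tmap i i (Delta (s r) * (y ⊗ 1)) * (1 ⊗ X).
Proof.
have := congr1 DeltaA (Xi r); rewrite !comulM !ext_comul DX [in RHS]mulrDr [in RHS]coef_tensr.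
by rewrite mulrDl (skew_tensl Xi) (skew_tensr Xi).
Qed.

Lemma skew_comul_sigma r : Delta (s r) = tmap s idfun (Delta r).
Proof.
have := congr1 (tmap p1 p0) (comulXi r); rewrite !linearD /= !tmap_left_linear //.
by rewrite p1X p01 p11 p0X tens0l !mulr0 !addr0 -tens_one !mulr1.
Qed.

Lemma skew_comul_sigmar r : Delta (s r) * (y ⊗ 1) = (y ⊗ 1) * tmap idfun s (Delta r).
Proof.
have := congr1 (tmap p0 p1) (comulXi r); rewrite !linearD /= !tmap_left_linear //.
by rewrite p1X p01 p11 p0X tens0l !mulr0 !add0r -tens_one !mulr1.
Qed.

End SkewVariable.

Section CommutationRelation.
Variables (xp xm : A) (a b yp ym : R) (sp sm : R -> R).
Hypothesis free : forall v1 vp vm vmp : R, exists p : {linear A -> R},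
  [/\ left_linear p, [/\ p 1 = v1, p xp = vp & p xm = vm] & p (xm * xp) = vmp].
Hypotheses (xpi : forall r, xp * i r = i (sp r) * xp) (xmi : forall r, xm * i r = i (sm r) * xm).
Hypothesis xpm : xp * xm = i a + i b * (xm * xp).
Hypothesis Dxp : DeltaA xp = xp ⊗ 1 + i yp ⊗ xp.
Hypothesis Dxm : DeltaA xm = xm ⊗ 1 + i ym ⊗ xm.

(* The identity Delta (xp xm) = Delta (a + b xm xp), read off in the coefficients p ⊗ q. *)
Let comul_xpm (p q : {linear A -> R}) : left_linear p -> left_linear q ->
  (a * p 1 + b * p (xm * xp)) ⊗ q 1 + (yp * p xm) ⊗ q xp +
    ((sp ym * p xp) ⊗ q xm + (yp * ym * p 1) ⊗ (a * q 1 + b * q (xm * xp))) =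
  Delta a * (p 1 ⊗ q 1) +
  Delta b * (p (xm * xp) ⊗ q 1 + (ym * p xp) ⊗ q xm +
    ((sm yp * p xm) ⊗ q xp + (ym * yp * p 1) ⊗ q (xm * xp))).
Proof.
move=> pl ql; have := congr1 (tmap p q \o DeltaA) xpm; rewrite /= linearD !comulM !ext_comul.
rewrite Dxp Dxm !(mulrDl, mulrDr) !tens_mul !mulr1 !mul1r xpi xmi xpm.
rewrite -[tmap i i (Delta a)]mulr1 [X in tmap i i (Delta a) * X]tens_one !linearD /=.
rewrite !tmap_left_linear // !tmap_tens !linearD /= -!rmorphM.
rewrite !pl !ql !(left_linear_coef _ pl) !(left_linear_coef _ ql) addrACA => ->.
by congr (_ + _); rewrite addrACA.
Qed.

Let epsr (t : (R ⊗ R)%type) : R := tlift (fun u v => (eps v : k) *: u) t.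
Let epsr_tens u v : epsr (u ⊗ v) = (eps v : k) *: u.
Proof. exact: (tlift_tens (winding_r_bilinear eps)). Qed.

(** The functionals chosen from here on pick, in this order, the coefficients of xm xp ⊗ 1, 1 ⊗ 1, 1
    ⊗ xm xp, xp ⊗ xm and xm ⊗ xp. The first one, followed by the counit, already makes b a
    scalar. *)
Let e2 : Delta b = b ⊗ 1.
Proof.
have [p [pl [p1 pp pm] pmp]] := free 0 0 0 1; have [q [ql [q1 qp qm] qmp]] := free 1 0 0 0.
have := comul_xpm pl ql; rewrite p1 pp pm pmp q1 qp qm qmp.
rewrite !(mulr0, mulr1, addr0, add0r, tens0l, tens0r).
by rewrite -?tens_one ?mulr1 => ->.
Qed.

Lemma commutation_scalar : b = (eps b : k) *: (1 : R).
Proof.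
have := esym (hopf_counitl H b); rewrite e2 (tlift_tens (winding_l_bilinear eps)).
exact: id.
Qed.

Let Delta_b : Delta b = (eps b : k) *: (1 : (R ⊗ R)%type).
Proof. by rewrite e2 {1}commutation_scalar tensZl. Qed.

Lemma commutation_skew_primitive : Delta a = a ⊗ 1 + (yp * ym) ⊗ a.
Proof.
have [p [pl [p1 pp pm] pmp]] := free 1 0 0 0.
have := comul_xpm pl pl; rewrite p1 pp pm pmp.
rewrite !(mulr0, mulr1, addr0, add0r, tens0l, tens0r).
by rewrite -?tens_one ?mulr1 => ->.
Qed.

Lemma commutation_factors : (eps b : k) *: (yp * ym) = (eps b : k) *: (ym * yp).
Proof.
have [p [pl [p1 pp pm] pmp]] := free 1 0 0 0; have [q [ql [q1 qp qm] qmp]] := free 0 0 0 1.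
have := comul_xpm pl ql; rewrite p1 pp pm pmp q1 qp qm qmp.
rewrite !(mulr0, mulr1, addr0, add0r, tens0l, tens0r).
rewrite Delta_b -tens_scaleAl mul1r -tensZr => /(congr1 epsr); rewrite !epsr_tens.
by rewrite linearZ rmorph1 => ->; congr (_ *: _); apply: mulr1.
Qed.

Lemma commutation_sigmap : sp ym = (eps b : k) *: ym.
Proof.
have [p [pl [p1 pp pm] pmp]] := free 0 1 0 0; have [q [ql [q1 qp qm] qmp]] := free 0 0 1 0.
have := comul_xpm pl ql; rewrite p1 pp pm pmp q1 qp qm qmp.
rewrite !(mulr0, mulr1, addr0, add0r, tens0l, tens0r).
rewrite Delta_b -tens_scaleAl mul1r -tensZl => /(congr1 epsr); rewrite !epsr_tens.
by rewrite rmorph1 !scale1r.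
Qed.

Lemma commutation_sigmam : yp = (eps b : k) *: sm yp.
Proof.
have [p [pl [p1 pp pm] pmp]] := free 0 0 1 0; have [q [ql [q1 qp qm] qmp]] := free 0 1 0 0.
have := comul_xpm pl ql; rewrite p1 pp pm pmp q1 qp qm qmp.
rewrite !(mulr0, mulr1, addr0, add0r, tens0l, tens0r).
rewrite Delta_b -tens_scaleAl mul1r -tensZl => /(congr1 epsr); rewrite !epsr_tens.
by rewrite rmorph1 !scale1r.
Qed.

End CommutationRelation.

End ExtendedComultiplication.

Section Conjugation.
Variables (k : fieldType) (R : algType k) (D : ambiskew_data R).

Lemma as_sigmaV_linear : linear (as_sigmaV D).
Proof. by move=> c x y; rewrite as_sigmaVD as_sigmaVZ. Qed.

HB.instance Definition _ := GRing.isLinear.Build k R R _ (as_sigmaV D) as_sigmaV_linear.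

Lemma as_sigmaV_monoid : monoid_morphism (as_sigmaV D).
Proof. by split; [exact: as_sigmaVM1 | exact: as_sigmaVM]. Qed.

HB.instance Definition _ := GRing.isMonoidMorphism.Build R R (as_sigmaV D) as_sigmaV_monoid.

Definition conjugation (r r' : R) (_ : inverse_of r r') (a : R) : R := r' * a * r.

Variables (r r' : R) (rr' : inverse_of r r').

Lemma conjugation_linear : linear (conjugation rr').
Proof. by move=> c a b; rewrite /conjugation mulrDr mulrDl -scalerAr -scalerAl. Qed.

HB.instance Definition _ := GRing.isLinear.Build k R R _ (conjugation rr') conjugation_linear.

Lemma conjugation_monoid : monoid_morphism (conjugation rr').
Proof.
case: (rr') => rK r'K; rewrite /conjugation; split=> [|a b]; first by rewrite mulr1.
by rewrite !mulrA -[_ * r * r']mulrA rK mulr1.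
Qed.

HB.instance Definition _ :=
  GRing.isMonoidMorphism.Build R R (conjugation rr') conjugation_monoid.

End Conjugation.

(** * Part (ii): the normalized presentation and its data *)

Section Converse.
Variables (k : fieldType) (R : algType k) (H : hopf R) (D : ambiskew_data R).
Variables (HA : hopf (ambiskew D)) (lp lm rp rm : R).

Local Notation A := (ambiskew D).
Local Notation i := (as_coef D).
Local Notation Xp := (as_Xp D).
Local Notation Xm := (as_Xm D).
Local Notation sigma := (as_sigma D).
Local Notation sigmaV := (as_sigmaV D).
Local Notation h := (as_h D).
Local Notation xi := (as_xi D).
Local Notation Delta := (hopf_comul H).
Local Notation eps := (hopf_counit H).
Local Notation S := (hopf_antipode H).

Hypothesis ext : hopf_extends H HA i.
Hypothesis Dp : hopf_comul HA Xp = Xp ⊗ i rp + i lp ⊗ Xp.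
Hypothesis Dm : hopf_comul HA Xm = Xm ⊗ i rm + i lm ⊗ Xm.

Let grp : grouplike H rp.
Proof.
have [p0 [p0l [p01 p0p p0m] _]] := low_degree_coefs D 1 0 0 0.
have [p1 [p1l [p11 p1p p1m] _]] := low_degree_coefs D 0 1 0 0.
exact: (skew_comul_grouplike_right ext p0l p1l p01 p0p p11 p1p Dp).
Qed.

Let glp : grouplike H lp.
Proof.
have [p0 [p0l [p01 p0p p0m] _]] := low_degree_coefs D 1 0 0 0.
have [p1 [p1l [p11 p1p p1m] _]] := low_degree_coefs D 0 1 0 0.
exact: (skew_comul_grouplike_left ext p0l p1l p01 p0p p11 p1p Dp).
Qed.

Let grm : grouplike H rm.
Proof.
have [p0 [p0l [p01 p0p p0m] _]] := low_degree_coefs D 1 0 0 0.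
have [p1 [p1l [p11 p1p p1m] _]] := low_degree_coefs D 0 0 1 0.
exact: (skew_comul_grouplike_right ext p0l p1l p01 p0m p11 p1m Dm).
Qed.

Let glm : grouplike H lm.
Proof.
have [p0 [p0l [p01 p0p p0m] _]] := low_degree_coefs D 1 0 0 0.
have [p1 [p1l [p11 p1p p1m] _]] := low_degree_coefs D 0 0 1 0.
exact: (skew_comul_grouplike_left ext p0l p1l p01 p0m p11 p1m Dm).
Qed.

Local Notation rp' := (S rp).
Local Notation rm' := (S rm).
Local Notation yp := (lp * rp').
Local Notation ym := (lm * rm').
Local Notation xp := (Xp * i rp').
Local Notation xm := (Xm * i rm').

Let rpV : inverse_of rp rp'. Proof. exact: grouplike_inv. Qed.
Let rmV : inverse_of rm rm'. Proof. exact: grouplike_inv. Qed.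
Let rpK : rp * rp' = 1. Proof. by case: rpV. Qed.
Let rpVK : rp' * rp = 1. Proof. by case: rpV. Qed.
Let rmK : rm * rm' = 1. Proof. by case: rmV. Qed.
Let rmVK : rm' * rm = 1. Proof. by case: rmV. Qed.
Let gyp : grouplike H yp. Proof. by apply: grouplikeM => //; apply: grouplikeV. Qed.
Let gym : grouplike H ym. Proof. by apply: grouplikeM => //; apply: grouplikeV. Qed.

Lemma comul_normalized X l r : grouplike H r -> hopf_comul HA X = X ⊗ i r + i l ⊗ X ->
  hopf_comul HA (X * i (S r)) = (X * i (S r)) ⊗ 1 + i (l * S r) ⊗ (X * i (S r)).
Proof.
move=> gr DX; have [rK _] := grouplike_inv gr; have [DV _] := grouplikeV gr.
rewrite comulM DX; case: ext => -> _ _.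
by rewrite DV tmap_tens mulrDl !tens_mul -!rmorphM rK rmorph1.
Qed.

Let Dxp : hopf_comul HA xp = xp ⊗ 1 + i yp ⊗ xp. Proof. exact: comul_normalized. Qed.
Let Dxm : hopf_comul HA xm = xm ⊗ 1 + i ym ⊗ xm. Proof. exact: comul_normalized. Qed.

(** [sp] and [sm] are the twists of the new variables; conjugations by the unrelated units r_+ and
    r_- hide that they are mutually inverse, which is only obtained in [smK] and [spK]. *)
Let sp : {lrmorphism R -> R} := sigma \o conjugation rpV.
Let sm : {lrmorphism R -> R} := sigmaV \o conjugation rmV.
Let spE a : sp a = sigma (rp' * a * rp). Proof. by []. Qed.
Let smE a : sm a = sigmaV (rm' * a * rm). Proof. by []. Qed.

Let xpE : xp = i (sigma rp') * Xp. Proof. exact: as_Xp_coef. Qed.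
Let xmE : xm = i (sigmaV rm') * Xm. Proof. exact: as_Xm_coef. Qed.

Let xpi r : xp * i r = i (sp r) * xp.
Proof.
rewrite spE -[LHS]mulrA -as_coefM !as_Xp_coef mulrA -!as_coefM -rmorphM.
by rewrite -(mulrA _ rp) rpK mulr1.
Qed.

Let xmi r : xm * i r = i (sm r) * xm.
Proof.
rewrite smE -[LHS]mulrA -as_coefM !as_Xm_coef mulrA -!as_coefM -rmorphM.
by rewrite -(mulrA _ rm) rmK mulr1.
Qed.

(* xp xm = u Xp Xm and xm xp = w Xm Xp. *)
Let u := sigma rp' * rm'.
Let u' := rm * sigma rp.
Let w := sigmaV rm' * rp'.
Let w' := rp * sigmaV rm.

Let uK : u * u' = 1.
Proof. by rewrite /u /u' mulrA -(mulrA _ rm') rmVK mulr1 -rmorphM rpVK rmorph1. Qed.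
Let u'K : u' * u = 1.
Proof. by rewrite /u /u' mulrA -(mulrA rm) -rmorphM rpK rmorph1 mulr1 rmK. Qed.
Let wK : w * w' = 1.
Proof. by rewrite /w /w' mulrA -(mulrA _ rp') rpVK mulr1 -rmorphM rmVK rmorph1. Qed.
Let w'K : w' * w = 1.
Proof. by rewrite /w /w' mulrA -(mulrA rp) -rmorphM rmK rmorph1 mulr1 rpK. Qed.

Let xmxp : xm * xp = i w * (Xm * Xp).
Proof.
rewrite xmE xpE -!mulrA (mulrA Xm) as_Xm_coef as_sigmaK.
by rewrite /w rmorphM !mulrA.
Qed.

(** Multiplying the old relation by u and substituting X_- X_+ = w^-1 xm xp gives the new
    coefficients, so far mere elements of R. *)
Let a := u * h.
Let b := xi *: (u * w').

Let xpxm : xp * xm = i a + i b * (xm * xp).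
Proof.
have -> : i b * (xm * xp) = xi *: (i u * (Xm * Xp)).
  by rewrite xmxp mulrA -as_coefM /b -scalerAl -mulrA w'K mulr1 linearZ /= scalerAl.
rewrite xmE xpE -!mulrA (mulrA Xp) as_Xp_coef as_sigmaVK !mulrA -as_coefM -/u.
by rewrite -!mulrA as_XpXm mulrDr -as_coefM -scalerAr.
Qed.

(** xp, xm and xm xp are the old monomials multiplied on the left by units, whose inverses correct
    the prescribed values. *)
Let free v1 vp vm vmp : exists p : {linear A -> R},
  [/\ left_linear i p, [/\ p 1 = v1, p xp = vp & p xm = vm] & p (xm * xp) = vmp].
Proof.
have [p [pl [p1 pp pm] pmp]] :=
  low_degree_coefs D v1 (sigma rp * vp) (sigmaV rm * vm) (w' * vmp).
exists p; split=> //; last by rewrite xmxp pl pmp mulrA wK mul1r.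
split=> //; first by rewrite xpE pl pp mulrA -rmorphM rpVK rmorph1 mul1r.
by rewrite xmE pl pm mulrA -rmorphM rmVK rmorph1 mul1r.
Qed.

Let xi' : k := eps b.

Let bE : b = xi'%:A. Proof. exact: (commutation_scalar ext free xpi xmi xpxm Dxp Dxm). Qed.

Let xi'_neq0 : xi' != 0.
Proof.
apply/eqP => xi0; have := bE; rewrite xi0 scale0r /b => /eqP.
rewrite scaler_eq0 (negPf (as_xi_neq0 D)) /= => /eqP uw0.
have /eqP : u' * (u * w') * w = 0 by rewrite uw0 mulr0 mul0r.
by rewrite mulrA u'K mul1r w'K oner_eq0.
Qed.

Let Da : Delta a = a ⊗ 1 + (yp * ym) ⊗ a.
Proof. exact: (commutation_skew_primitive ext free xpi xmi xpxm Dxp Dxm). Qed.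

Let ypm : yp * ym = ym * yp.
Proof.
exact: (scalerI xi'_neq0) (commutation_factors ext free xpi xmi xpxm Dxp Dxm).
Qed.

Let sp_ym : sp ym = xi' *: ym.
Proof. exact: (commutation_sigmap ext free xpi xmi xpxm Dxp Dxm). Qed.

Let sm_yp : yp = xi' *: sm yp.
Proof. exact: (commutation_sigmam ext free xpi xmi xpxm Dxp Dxm). Qed.

Let Dsp r : Delta (sp r) = tmap sp idfun (Delta r).
Proof.
have [p0 [p0l [p01 p0p p0m] _]] := free 1 0 0 0.
have [p1 [p1l [p11 p1p p1m] _]] := free 0 1 0 0.
exact: (skew_comul_sigma ext p0l p1l p01 p0p p11 p1p xpi Dxp).
Qed.

Let Dspr r : Delta (sp r) * (yp ⊗ 1) = (yp ⊗ 1) * tmap idfun sp (Delta r).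
Proof.
have [p0 [p0l [p01 p0p p0m] _]] := free 1 0 0 0.
have [p1 [p1l [p11 p1p p1m] _]] := free 0 1 0 0.
exact: (skew_comul_sigmar ext p0l p1l p01 p0p p11 p1p xpi Dxp).
Qed.

Let Dsm r : Delta (sm r) = tmap sm idfun (Delta r).
Proof.
have [p0 [p0l [p01 p0p p0m] _]] := free 1 0 0 0.
have [p1 [p1l [p11 p1p p1m] _]] := free 0 0 1 0.
exact: (skew_comul_sigma ext p0l p1l p01 p0m p11 p1m xmi Dxm).
Qed.

Let Dsmr r : Delta (sm r) * (ym ⊗ 1) = (ym ⊗ 1) * tmap idfun sm (Delta r).
Proof.
have [p0 [p0l [p01 p0p p0m] _]] := free 1 0 0 0.
have [p1 [p1l [p11 p1p p1m] _]] := free 0 0 1 0.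
exact: (skew_comul_sigmar ext p0l p1l p01 p0m p11 p1m xmi Dxm).
Qed.

Let eps_conj v v' r : v * v' = 1 -> eps (v * r * v') = eps r.
Proof.
move=> /(congr1 eps); rewrite !rmorphM rmorph1 /= => e.
by rewrite [_ * eps r]mulrC -mulrA e; apply: mulr1.
Qed.

Let spsm_conj r : sp (sm r) = u * r * u'.
Proof. by rewrite spE smE !rmorphM /= !as_sigmaVK /u /u' !mulrA. Qed.

Let smsp_conj r : sm (sp r) = w * r * w'.
Proof. by rewrite spE smE !rmorphM /= !as_sigmaK /w /w' !mulrA. Qed.

(* sp o sm is at once an inner automorphism, so that it preserves eps, and a winding
   automorphism; hence it is the winding automorphism of eps, that is the identity. *)
Let smK : cancel sm sp.
Proof.
move=> a0; apply: (@left_invariant_id _ _ H (sp \o sm : {lrmorphism R -> R}) _ _ a0) => r.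
  by rewrite -[_ r]/(sp (sm r)) Dsp Dsm tmap_comp; apply: eq_tmap.
by rewrite -[_ r]/(sp (sm r)) spsm_conj eps_conj.
Qed.

Let spK : cancel sp sm.
Proof.
move=> a0; apply: (@left_invariant_id _ _ H (sm \o sp : {lrmorphism R -> R}) _ _ a0) => r.
  by rewrite -[_ r]/(sm (sp r)) Dsm Dsp tmap_comp; apply: eq_tmap.
by rewrite -[_ r]/(sm (sp r)) smsp_conj eps_conj.
Qed.

(** Conjugation by u is [sp \o sm], now known to be the identity. *)
Let uC : central u.
Proof. by move=> r; rewrite -[in RHS](smK r) spsm_conj -mulrA u'K mulr1. Qed.

Let aC : central a.
Proof. by move=> r; rewrite /a -(mulrA u) (as_h_central D) mulrA uC -(mulrA r). Qed.

Let chi : {lrmorphism R -> k^o} := eps \o sp.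

Let sp_winding r : sp r = winding_l H chi r.
Proof. exact: left_invariant_winding. Qed.

(** Obtained from [Dspr] by applying id ⊗ eps; with [sp_winding] it is the required identity tau^l =
    ad(y_+) tau^r. *)
Let sp_yp r : sp r * yp = yp * winding_r H chi r.
Proof.
have := congr1 (tlift (fun u v => (eps v : k) *: u)) (Dspr r).
have bM := tlift_mul (winding_r_bilinear eps).
rewrite !bM; try by move=> a1 a2 b1 b2; rewrite rmorphM -scalerAl -scalerAr scalerA.
rewrite hopf_counitr (tlift_tens (winding_r_bilinear eps)) rmorph1 scale1r => ->.
by rewrite tlift_tmap //; exact: winding_r_bilinear.
Qed.

(** Chaining [Dsmr] with [Dspr] cancels the twists and shows that y_- y_+ ⊗ 1 commutes with Delta r;
    id ⊗ eps concludes. *)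
Let zC : central (yp * ym).
Proof.
move=> r; rewrite ypm.
have : Delta r * ((ym * yp) ⊗ 1) = ((ym * yp) ⊗ 1) * Delta r.
  rewrite -{1}[r]spK -[1]mulr1 -tens_mul mulrA Dsmr -mulrA.
  have -> : tmap idfun sm (Delta (sp r)) * (yp ⊗ 1) =
      tmap idfun sm (Delta (sp r) * (yp ⊗ 1)).
    by rewrite tmap_mul tmap_tens rmorph1.
  rewrite Dspr tmap_mul tmap_tens rmorph1 tmap_comp mulrA tens_mul mulr1; congr (_ * _).
  by rewrite -[RHS]tmap_id; apply: eq_tmap => // x; apply: spK.
move/(congr1 (tlift (fun u v => (eps v : k) *: u))).
have bM := tlift_mul (winding_r_bilinear eps).
rewrite !bM; try by move=> a1 a2 b1 b2; rewrite rmorphM -scalerAl -scalerAr scalerA.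
by rewrite hopf_counitr (tlift_tens (winding_r_bilinear eps)) rmorph1 scale1r => ->.
Qed.

(** On a grouplike g both winding maps multiply by the nonzero scalar chi(g), so [sp_yp] at g reads
    g y_+ = y_+ g. *)
Let yp_central : central_grouplike H yp.
Proof.
split=> // g gg; have := sp_yp g; rewrite sp_winding winding_l_grouplike // winding_r_grouplike //.
rewrite -scalerAl -scalerAr => e; apply: (scalerI (char_grouplike_neq0 chi gg)).
exact: esym.
Qed.

Let ym_central : central_grouplike H ym.
Proof.
split=> // g gg; have [_ Vyp] := grouplike_inv gyp; have [_ ypC] := yp_central.
have e : yp * (ym * g) = yp * (g * ym) by rewrite mulrA zC mulrA -ypC // [RHS]mulrA.
by rewrite -[LHS]mul1r -Vyp -[LHS]mulrA e mulrA Vyp mul1r.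
Qed.

Let chi_ym : chi ym = xi'.
Proof. by case: gym => _ e; rewrite -[LHS]/(eps (sp ym)) sp_ym linearZ /= e; apply: mulr1. Qed.

Let chi_yp : chi yp = xi'.
Proof.
case: gyp => _ e; rewrite -[LHS]/(eps (sp yp)).
have -> : sp yp = xi' *: yp.
  transitivity (sp (xi' *: sm yp)); first by rewrite -sm_yp.
  by rewrite linearZ; congr (_ *: _); apply: smK.
by rewrite linearZ /= e; apply: mulr1.
Qed.

Let D' : ambiskew_data R := AmbiskewData (as_sigma := sp) (as_sigmaV := sm) spK smK aC xi'_neq0.

Let conditions : hopf_conditions H chi (yp * ym) a yp ym.
Proof.
split=> //; first exact: grouplikeM.
  by rewrite chi_yp chi_ym.
move=> r /=; rewrite -sp_winding ad_l_grouplike // -sp_yp.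
by have [ypV _] := grouplike_inv gyp; rewrite -mulrA ypV mulr1.
Qed.

Let hom : ambiskew_hom D' i xp xm.
Proof.
split=> //; [exact: as_coefD | exact: as_coefM |].
by rewrite xpxm bE.
Qed.

(** The old variables, recovered as xp r_+ and xm r_-, satisfy the old relations in the newly
    presented algebra; this provides the inverse of the presentation map. *)
Let hom' : ambiskew_hom D (as_coef D') (as_Xp D' * as_coef D' rp) (as_Xm D' * as_coef D' rm).
Proof.
have XpC := as_Xp_coef D'; have XmC := as_Xm_coef D'.
split=> [||//|r|r|]; [exact: as_coefD | exact: as_coefM | | |].
- rewrite -[LHS]mulrA -as_coefM !XpC mulrA -as_coefM; congr (as_coef D' _ * _).
  rewrite -[as_sigma D' _]/(sp _) -[as_sigma D' rp]/(sp _) !spE.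
  by rewrite -rmorphM !mulrA rpVK mul1r -(mulrA r) rpVK mulr1.
- rewrite -[LHS]mulrA -as_coefM !XmC mulrA -as_coefM; congr (as_coef D' _ * _).
  rewrite -[as_sigmaV D' _]/(sm _) -[as_sigmaV D' rm]/(sm _) !smE.
  by rewrite -rmorphM !mulrA rmVK mul1r -(mulrA r) rmVK mulr1.
have E1 : as_Xp D' * as_coef D' rp * (as_Xm D' * as_coef D' rm) =
    as_coef D' u' * (as_Xp D' * as_Xm D').
  rewrite XpC XmC -mulrA (mulrA (as_Xp D')) XpC !mulrA -as_coefM; congr (as_coef D' _ * _ * _).
  rewrite -[as_sigma D' rp]/(sp rp) -[as_sigma D' _]/(sp (sm rm)) spE spsm_conj.
  rewrite mulrA rpVK mul1r /u -!mulrA (mulrA rm') rmVK mul1r mulrA -rmorphM rpK.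
  by rewrite rmorph1 mul1r.
have E2 : as_Xm D' * as_coef D' rm * (as_Xp D' * as_coef D' rp) =
    as_coef D' w' * (as_Xm D' * as_Xp D').
  rewrite XpC XmC -mulrA (mulrA (as_Xm D')) XmC !mulrA -as_coefM; congr (as_coef D' _ * _ * _).
  rewrite -[as_sigmaV D' rm]/(sm rm) -[as_sigmaV D' _]/(sm (sp rp)) smE smsp_conj.
  rewrite mulrA rmVK mul1r /w -!mulrA (mulrA rp') rpVK mul1r mulrA -rmorphM rmK.
  by rewrite rmorph1 mul1r.
rewrite E1 E2 as_XpXm mulrDr -as_coefM -[as_h D']/(u * h) (mulrA u') u'K mul1r; congr (_ + _).
rewrite -[as_xi D']/xi' linearZ /= rmorph1 -scalerAl mul1r -scalerAr !scalerAl -!linearZ.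
congr (as_coef D' _ * _).
(* u^-1 b is computed in two ways: b is the scalar xi', and b was defined as xi u w^-1. *)
have <- : u' * b = xi' *: u' by rewrite bE -scalerAr mulr1.
by rewrite /b -scalerAr mulrA u'K mul1r.
Qed.

Let presented : presented_by D' i xp xm.
Proof.
have [phi phiE] := as_lift_lrmorphism hom; have [psi psiE] := as_lift_lrmorphism hom'.
have phi_coef r : phi (as_coef D' r) = i r by rewrite phiE as_lift_coef.
have phi_Xp : phi (as_Xp D') = xp by rewrite phiE (as_lift_Xp hom).
have phi_Xm : phi (as_Xm D') = xm by rewrite phiE (as_lift_Xm hom).
have psi_coef r : psi (i r) = as_coef D' r by rewrite psiE as_lift_coef.
have psi_Xp : psi Xp = as_Xp D' * as_coef D' rp by rewrite psiE (as_lift_Xp hom').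
have psi_Xm : psi Xm = as_Xm D' * as_coef D' rm by rewrite psiE (as_lift_Xm hom').
exists phi; split=> //; exists psi; elim/as_gen_ind => [r|||x y IHx IHy|x y IHx IHy].
- by rewrite phi_coef psi_coef.
- by rewrite phi_Xp rmorphM /= psi_Xp psi_coef -mulrA -as_coefM rpK rmorph1 mulr1.
- by rewrite phi_Xm rmorphM /= psi_Xm psi_coef -mulrA -as_coefM rmK rmorph1 mulr1.
- by rewrite !rmorphD /= IHx IHy.
- by rewrite !rmorphM /= IHx IHy.
- by rewrite psi_coef phi_coef.
- by rewrite psi_Xp rmorphM /= phi_Xp phi_coef -mulrA -as_coefM rpVK rmorph1 mulr1.
- by rewrite psi_Xm rmorphM /= phi_Xm phi_coef -mulrA -as_coefM rmVK rmorph1 mulr1.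
- by rewrite !rmorphD /= IHx IHy.
- by rewrite !rmorphM /= IHx IHy.
Qed.

Lemma hopf_ambiskew_converse : exists rp' rm' : R,
  [/\ inverse_of rp rp', inverse_of rm rm' &
    let Xp := as_Xp D * as_coef D rp' in
    let Xm := as_Xm D * as_coef D rm' in
    let yp := lp * rp' in
    let ym := lm * rm' in
    exists (D' : ambiskew_data R) (chi : {lrmorphism R -> k^o}),
      [/\ presented_by D' (as_coef D) Xp Xm,
          hopf_comul HA Xp = Xp ⊗ 1 + as_coef D yp ⊗ Xp,
          hopf_comul HA Xm = Xm ⊗ 1 + as_coef D ym ⊗ Xm,
          hopf_conditions H chi (yp * ym) (as_h D') yp ym &
          data_of H chi (as_h D') yp D']].
Proof.
exists (S rp), (S rm); split=> //=; by exists D', chi; split.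
Qed.

End Converse.

Theorem theorem2p4 (k : fieldType) (R : algType k) (H : hopf R) :
  (* (i) *)
  (forall (chi : {lrmorphism R -> k^o}) (z h yp ym : R),
     hopf_conditions H chi z h yp ym ->
     exists D : ambiskew_data R,
       data_of H chi h yp D /\
       exists HA : hopf (ambiskew D),
         [/\ hopf_extends H HA (as_coef D),
             hopf_comul HA (as_Xp D) = as_Xp D ⊗ 1 + as_coef D yp ⊗ as_Xp D,
             hopf_comul HA (as_Xm D) = as_Xm D ⊗ 1 + as_coef D ym ⊗ as_Xm D &
             exists yp' ym' : R,
               [/\ inverse_of yp yp', inverse_of ym ym',
                   hopf_antipode HA (as_Xp D) = - as_coef D yp' * as_Xp D &
                   hopf_antipode HA (as_Xm D) = - as_coef D ym' * as_Xm D]])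
  /\
  (* (ii) *)
  (forall (D : ambiskew_data R) (HA : hopf (ambiskew D)) (lp lm rp rm : R),
     hopf_extends H HA (as_coef D) ->
     hopf_comul HA (as_Xp D) =
       as_Xp D ⊗ as_coef D rp + as_coef D lp ⊗ as_Xp D ->
     hopf_comul HA (as_Xm D) =
       as_Xm D ⊗ as_coef D rm + as_coef D lm ⊗ as_Xm D ->
     exists rp' rm' : R,
       [/\ inverse_of rp rp', inverse_of rm rm' &
         let Xp := as_Xp D * as_coef D rp' in
         let Xm := as_Xm D * as_coef D rm' in
         let yp := lp * rp' in
         let ym := lm * rm' in
         exists (D' : ambiskew_data R) (chi : {lrmorphism R -> k^o}),
           [/\ presented_by D' (as_coef D) Xp Xm,
               hopf_comul HA Xp = Xp ⊗ 1 + as_coef D yp ⊗ Xp,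
               hopf_comul HA Xm = Xm ⊗ 1 + as_coef D ym ⊗ Xm,
               hopf_conditions H chi (yp * ym) (as_h D') yp ym &
               data_of H chi (as_h D') yp D']]).
Proof.
split=> [chi z h yp ym hc|D HA lp lm rp rm ext Dp Dm].
  exists (hopf_ambiskew_data hc); split=> //.
  have [HA [ext Dp Dm Sp Sm]] := hopf_ambiskew_hopf hc.
  have [gp _] := hc_yp hc; have [gm _] := hc_ym hc.
  exists HA; split=> //; exists (hopf_antipode H yp), (hopf_antipode H ym).
  by split=> //; apply: grouplike_inv.
exact: (hopf_ambiskew_converse ext Dp Dm).
Qed.
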